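(* Let $-\infty\le a<b\le\infty$ and let $\varrho,\varsigma,\chi$ be locally finite complex Borel measures on $(a,b)$ with $\operatorname{supp}(\varsigma)=(a,b)$. Fix $g\in L^1_{loc}((a,b);|\varrho|)$. Then for every $z\in\mathbb{C}$, $c\in(a,b)$ and $d_1,d_2\in\mathbb{C}$ there is a unique $u\in\mathfrak{D}_\tau$ with $(\tau-z)u=g$ (i.e. $\tau u-zu=g$ $|\varrho|$-a.e.), $u(c)=d_1$ and $u^{[1]}(c)=d_2$, if and only if $$\varrho(\{x\})\varsigma(\{x\})=0\quad\text{and}\quad \chi(\{x\})\varsigma(\{x\})\neq 1\qquad\text{for all }x\in(a,b).$$ If, in addition, the measures $\varrho,\varsigma,\chi$ are real-valued and $g$, $d_1$, $d_2$ and $z$ are real, then this solution is real-valued.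
   Context: For a locally finite complex Borel measure $\mu$ on $(a,b)$, $c,x\in(a,b)$ and $h\in L^1_{loc}((a,b);|\mu|)$ one sets $\int_c^x h\,d\mu=\int_{[c,x)}h\,d\mu$ if $x>c$, $=0$ if $x=c$, and $=-\int_{[x,c)}h\,d\mu$ if $x<c$. $AC_{loc}((a,b);\mu)$ is the set of functions $f(x)=f(c)+\int_c^x h\,d\mu$, $x\in(a,b)$, with $h\in L^1_{loc}((a,b);|\mu|)$; $h=\frac{df}{d\mu}$ is its Radon–Nikodym derivative. $\mathfrak{D}_\tau$ is the set of $f\in AC_{loc}((a,b);\varsigma)$ for which there is a function $F\in AC_{loc}((a,b);\varrho)$ with $F(x)=-\frac{df}{d\varsigma}(x)+\int_c^x f\,d\chi$ for $|\varsigma|$-a.e. $x$ (for some, hence all, $c\in(a,b)$); $F$ is unique since $\operatorname{supp}\varsigma=(a,b)$, and one defines $\tau f:=\frac{dF}{d\varrho}\in L^1_{loc}((a,b);|\varrho|)$ and the quasi-derivative $f^{[1]}(x):=\int_c^x f\,d\chi-F(x)$ (a pointwise representative of $\frac{df}{d\varsigma}$). *)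

(* Defs.v *)
From HB Require Import structures.
From mathcomp Require Import all_boot all_order all_algebra.
From mathcomp Require Import all_classical all_reals all_analysis.
From mathcomp Require Import complex.

Set Implicit Arguments.
Unset Strict Implicit.
Unset Printing Implicit Defensive.

Import Order.TTheory GRing.Theory Num.Theory.
Local Open Scope classical_set_scope.
Local Open Scope ring_scope.

Section LocallyFiniteComplexMeasures.
Variable R : realType.
Variables a b : \bar R.

Definition Iab : set R := [set x : R | (a < x%:E)%E /\ (x%:E < b)%E].

(* A locally finite complex Borel measure mu on (a,b), given through its
   (minimal) Jordan decomposition
     mu = (cm1 - cm2) + i (cm3 - cm4),
   with cm1..cm4 positive Borel measures on R, carried by (a,b), finite on
   compact subintervals of (a,b), and cm1 _|_ cm2, cm3 _|_ cm4.
   Every locally finite complex Borel measure on (a,b) arises this way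
   (in a unique way), and conversely. *)
Record lfcm := LFCM {
  cm1 : {measure set R -> \bar R};
  cm2 : {measure set R -> \bar R};
  cm3 : {measure set R -> \bar R};
  cm4 : {measure set R -> \bar R};
  cm1_out : cm1 (~` Iab) = 0%E;
  cm2_out : cm2 (~` Iab) = 0%E;
  cm3_out : cm3 (~` Iab) = 0%E;
  cm4_out : cm4 (~` Iab) = 0%E;
  cm1_fin : forall al be, Iab al -> Iab be -> (cm1 `[al, be]%classic < +oo)%E;
  cm2_fin : forall al be, Iab al -> Iab be -> (cm2 `[al, be]%classic < +oo)%E;
  cm3_fin : forall al be, Iab al -> Iab be -> (cm3 `[al, be]%classic < +oo)%E;
  cm4_fin : forall al be, Iab al -> Iab be -> (cm4 `[al, be]%classic < +oo)%E;
  cm12_sing : exists A, [/\ measurable A, cm1 A = 0%E & cm2 (~` A) = 0%E];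
  cm34_sing : exists A, [/\ measurable A, cm3 A = 0%E & cm4 (~` A) = 0%E]
}.

Variable mu : lfcm.

(* value mu(A) of the complex measure on a relatively compact Borel set A *)
Definition cmeas (A : set R) : R[i] :=
  Complex (fine (cm1 mu A) - fine (cm2 mu A)) (fine (cm3 mu A) - fine (cm4 mu A)).

(* a measure equivalent to the variation |mu| (|mu| <= tv <= 2|mu|) *)
Definition tv (A : set R) : \bar R :=
  (cm1 mu A + cm2 mu A + cm3 mu A + cm4 mu A)%E.

Definition ae (P : R -> Prop) : Prop :=
  exists N, [/\ measurable N, tv N = 0%E & forall x, Iab x -> ~ N x -> P x].

Definition supp : set R :=
  [set x | Iab x /\ forall e : R, 0 < e -> (0 < tv (`](x - e)%R, (x + e)%R[%classic `&` Iab))%E].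

Definition L1loc (h : R -> R[i]) : Prop :=
  [/\ measurable_fun Iab (fun x => complex.Re (h x)),
      measurable_fun Iab (fun x => complex.Im (h x)) &
      forall al be, Iab al -> Iab be ->
      let nh := fun x => ((`|complex.Re (h x)| + `|complex.Im (h x)|)%:E) in
      [/\ (\int[cm1 mu]_(x in `[al, be]%classic) nh x < +oo)%E,
          (\int[cm2 mu]_(x in `[al, be]%classic) nh x < +oo)%E,
          (\int[cm3 mu]_(x in `[al, be]%classic) nh x < +oo)%E &
          (\int[cm4 mu]_(x in `[al, be]%classic) nh x < +oo)%E]].

Definition cint (A : set R) (h : R -> R[i]) : R[i] :=
  let hr := fun x => complex.Re (h x) in
  let hi := fun x => complex.Im (h x) in
  Complex
    (Rintegral (cm1 mu) A hr - Rintegral (cm2 mu) A hr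
     - Rintegral (cm3 mu) A hi + Rintegral (cm4 mu) A hi)
    (Rintegral (cm1 mu) A hi - Rintegral (cm2 mu) A hi
     + Rintegral (cm3 mu) A hr - Rintegral (cm4 mu) A hr).

Definition cint_from (c x : R) (h : R -> R[i]) : R[i] :=
  if c < x then cint `[c, x[%classic h
  else if x == c then 0 else - cint `[x, c[%classic h.

Definition ACloc (f h : R -> R[i]) : Prop :=
  L1loc h /\ exists c, Iab c /\ forall x, Iab x -> f x = f c + cint_from c x h.

Definition real_cm : Prop :=
  forall A, measurable A ->
    (exists al be, [/\ Iab al, Iab be & A `<=` `[al, be]%classic]) ->
    complex.Im (cmeas A) = 0.

End LocallyFiniteComplexMeasures.

Arguments Iab {R}.

(* u is a solution of the initial value problem
     u in D_tau,  (tau - z) u = g,  u(c) = d1,  u^[1](c) = d2.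
   Witnesses: a base point c0, du/dsig = h, the function F of the definition
   of D_tau (with base point c0), and tau u = dF/drho = k;
   the quasi-derivative is u^[1](x) = int_{c0}^x u dchi - F(x). *)
Definition is_solution (R : realType) (a b : \bar R) (rho sig chi : lfcm a b)
  (g : R -> R[i]) (z : R[i]) (c : R) (d1 d2 : R[i]) (u : R -> R[i]) : Prop :=
  exists c0 (h F k : R -> R[i]),
    [/\ Iab a b c0, ACloc sig u h, ACloc rho F k,
        ae sig (fun x => F x = - h x + cint_from chi c0 x u) &
        [/\ ae rho (fun x => k x - z * u x = g x),
             u c = d1 &
             cint_from chi c0 c u - F c = d2]].

(* Main.v *)
(** With v := u^[1], the problem (tau - z) u = g is the first-order system
      u(y) - u(x) = int_[x,y) v dsig,
      v(y) - v(x) = int_[x,y) u dchi - z int_[x,y) u drho - int_[x,y) g drho.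
    Across a point x the homogeneous system jumps by the matrix
      ( 1                          sig({x}) )
      ( chi({x}) - z rho({x})      1        )
    of determinant 1 - sig({x}) (chi({x}) - z rho({x})), and the condition of the
    theorem says exactly that no jump is singular, for any z.  On an interval
    whose interior has small total variation the integral operators, with the
    atom at the left end point removed, are contractions, so the system is
    uniquely solvable from any point of the interval; the value at the left end
    point is then recovered by inverting the jump there.  Concatenation and real
    induction give all compact intervals, hence (a,b).  Conversely, at a singular
    jump two solutions starting at x with data differing by a vector of the
    kernel of the jump can be glued, and uniqueness fails from any c > x.
    For real data the imaginary parts solve the homogeneous system with zero data. *)

Require Import Defs.
From HB Require Import structures.
From mathcomp Require Import all_boot all_order all_algebra.
From mathcomp Require Import all_classical all_reals all_analysis.
From mathcomp Require Import measurable_realfun complex ring lra.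
Import Order.TTheory GRing.Theory Num.Theory.
Local Open Scope classical_set_scope.
Local Open Scope ring_scope.

Set Implicit Arguments.
Unset Strict Implicit.
Unset Printing Implicit Defensive.

(** * Integrals against a positive measure *)

Section PositiveMeasure.
Variables (R : realType) (m : {measure set R -> \bar R}).
Implicit Types (A : set R) (f : R -> R).

Lemma Rintegral_lin A (f1 f2 f3 : R -> R) (p q : R) : measurable A ->
  m.-integrable A (EFin \o f1) -> m.-integrable A (EFin \o f2) ->
  m.-integrable A (EFin \o f3) ->
  Rintegral m A (fun x => p * f1 x + q * f2 x + f3 x) =
  p * Rintegral m A f1 + q * Rintegral m A f2 + Rintegral m A f3.
Proof.
move=> mA i1 i2 i3.
have j1 : m.-integrable A (EFin \o (fun x => p * f1 x)) by exact: (integrableZl mA p i1).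
have j2 : m.-integrable A (EFin \o (fun x => q * f2 x)) by exact: (integrableZl mA q i2).
rewrite RintegralD// ?RintegralD// ?RintegralZl//.
exact: (integrableD mA j1 j2).
Qed.

Lemma integrable_lin A (f1 f2 f3 : R -> R) (p q : R) : measurable A ->
  m.-integrable A (EFin \o f1) -> m.-integrable A (EFin \o f2) ->
  m.-integrable A (EFin \o f3) ->
  m.-integrable A (EFin \o (fun x => p * f1 x + q * f2 x + f3 x)).
Proof.
move=> mA i1 i2 i3.
have j1 : m.-integrable A (EFin \o (fun x => p * f1 x)) by exact: (integrableZl mA p i1).
have j2 : m.-integrable A (EFin \o (fun x => q * f2 x)) by exact: (integrableZl mA q i2).
exact: (integrableD mA (integrableD mA j1 j2) i3).
Qed.

(** Estimating the two functions together passes a bound on [|f| + |g|] to the integrals without a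
    factor 2; they will be the real and imaginary parts of one integrand. *)
Lemma normr_Rintegral2_le A (f g : R -> R) (B : R) : measurable A ->
  (m A < +oo)%E ->
  m.-integrable A (EFin \o f) -> m.-integrable A (EFin \o g) ->
  (forall x, A x -> `|f x| + `|g x| <= B) ->
  `|Rintegral m A f| + `|Rintegral m A g| <= B * fine (m A).
Proof.
move=> mA Afin iF iG fgB.
have iF' : m.-integrable A (EFin \o (fun x => `|f x|)) by exact: integrable_abse iF.
have iG' : m.-integrable A (EFin \o (fun x => `|g x|)) by exact: integrable_abse iG.
apply: le_trans (lerD (le_normr_Rintegral mA iF) (le_normr_Rintegral mA iG)) _.
rewrite -RintegralD// -Rintegral_cst//; apply: le_Rintegral => //.
- exact: (integrableD mA iF' iG').
- apply: (@measurable_bounded_integrable _ _ _ m (cst B)) => //.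
  by exists `|B|; split=> // x Bx y _ /=; exact: ltW.
Qed.

Lemma Rintegral_set1E f (x : R) : Rintegral m [set x] f = fine (m [set x]) * f x.
Proof.
rewrite (@eq_Rintegral _ _ _ _ _ (cst (f x))) ?Rintegral_cst// 1?mulrC//.
by move=> y; rewrite inE => ->.
Qed.

(** The primitive of a nonnegative function is nondecreasing, hence Borel. *)
Lemma nneg_measurable_Rintegral_lt A f : measurable A ->
  m.-integrable A (EFin \o f) -> (forall x, 0 <= f x) ->
  measurable_fun [set: R] (fun x => Rintegral m (A `&` `]-oo, x[%classic) f).
Proof.
move=> mA iF f0; apply: nondecreasing_measurable => // x y xy.
have sub : A `&` `]-oo, x[ `<=` A `&` `]-oo, y[.
  by move=> t [At]; rewrite /= !in_itv/= => tx; split=> //; exact: lt_le_trans xy.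
have mAx z : measurable (A `&` `]-oo, z[%classic) by exact: measurableI.
have iz z : m.-integrable (A `&` `]-oo, z[%classic) (EFin \o f).
  by apply: integrableS iF => // t [].
apply: fine_le.
- by apply: integrable_fin_num => //; exact: iz.
- by apply: integrable_fin_num => //; exact: iz.
apply: ge0_subset_integral => //; last by move=> t _; rewrite lee_fin.
by have /integrableP[] := iz y.
Qed.

Lemma measurable_Rintegral_lt A f : measurable A ->
  m.-integrable A (EFin \o f) ->
  measurable_fun [set: R] (fun x => Rintegral m (A `&` `]-oo, x[%classic) f).
Proof.
move=> mA iF.
have ip : m.-integrable A (EFin \o f^\+).
  apply: (le_integrable mA _ _ iF) => //=.
    by apply/measurable_EFinP/measurable_funrpos/measurable_EFinP; case/integrableP: iF.
  move=> x Ax; rewrite lee_fin ger0_norm /funrpos; last by rewrite le_max lexx orbT.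
  by rewrite ge_max normr_ge0 ler_norm.
have in_ : m.-integrable A (EFin \o f^\-).
  apply: (le_integrable mA _ _ iF) => //=.
    by apply/measurable_EFinP/measurable_funrneg/measurable_EFinP; case/integrableP: iF.
  move=> x Ax; rewrite lee_fin ger0_norm /funrneg; last by rewrite le_max lexx orbT.
  by rewrite ge_max normr_ge0 -normrN ler_norm.
rewrite (_ : (fun x => _) = (fun x => Rintegral m (A `&` `]-oo, x[%classic) f^\+)
    \- (fun x => Rintegral m (A `&` `]-oo, x[%classic) f^\-)); last first.
  apply/funext => x /=; have mAx : measurable (A `&` `]-oo, x[%classic) by exact: measurableI.
  rewrite -RintegralB//; first last.
    by apply: integrableS in_ => // t [].
    by apply: integrableS ip => // t [].
  by apply: eq_Rintegral => t _; rewrite -[in LHS](funrposBneg f).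
by apply: measurable_funB; apply: nneg_measurable_Rintegral_lt.
Qed.

Lemma null_eq_Rintegral A (N : set R) (f g : R -> R) : measurable A -> measurable N ->
  m N = 0%E -> m.-integrable A (EFin \o f) -> m.-integrable A (EFin \o g) ->
  (forall x, A x -> ~ N x -> f x = g x) -> Rintegral m A f = Rintegral m A g.
Proof.
move=> mA mN N0 iF iG fg; rewrite /Rintegral; congr fine.
rewrite (negligible_integral mN mA iF N0) (negligible_integral mN mA iG N0).
by apply: eq_integral => x; rewrite inE => -[Ax Nx] /=; rewrite fg.
Qed.

(** Continuity from above along a sequence shrinking to the empty set. *)
Lemma measure_small (F : (set R)^nat) (e : R) : 0 < e ->
  (m (F 0%N) < +oo)%E -> (forall n, measurable (F n)) ->
  \bigcap_n F n = set0 -> nonincreasing_seq F -> exists n, (m (F n) <= e%:E)%E.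
Proof.
move=> e0 F0 mF capF niF.
have := nonincreasing_cvg_mu F0 mF _ niF; rewrite capF measure0 => /(_ measurable0).
move=> /fine_cvgP[[n1 _ fin]] /cvgrPdist_le/(_ _ e0)[n2 _ le2].
pose n := maxn n1 n2; exists n.
have nfin : m (F n) \is a fin_num by apply: fin; rewrite /= leq_maxl.
have := le2 n; rewrite /= leq_maxr => /(_ isT).
rewrite sub0r normrN ger0_norm ?fine_ge0// => le.
by rewrite -(fineK nfin) lee_fin.
Qed.

(** The intervals exclude [x], so they shrink to the empty set even if [m] has an atom at [x]. *)
Lemma measure_small_right (x d e : R) : 0 < d -> 0 < e ->
  (m `]x, (x + d)%R[%classic < +oo)%E ->
  exists2 d', 0 < d' & (m `]x, (x + d')%R[%classic <= e%:E)%E.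
Proof.
move=> d0 e0 fin; pose F n : set R := `]x, (x + d / n.+1%:R)[%classic.
have dn n : 0 < d / n.+1%:R by rewrite divr_gt0.
have [n Fn] : exists n, (m (F n) <= e%:E)%E; last by exists (d / n.+1%:R).
apply: measure_small => //; first by rewrite /F divr1.
  by move=> n; exact: measurable_itv.
  apply/seteqP; split=> // t Ft.
  have := Ft 0%N I; rewrite /F /= in_itv/= => /andP[xt _].
  have tx : 0 < t - x by rewrite subr_gt0.
  (* Any [n] above [d / (t - x)] puts [t] outside [F n]. *)
  have /archi_boundP := ltW (divr_gt0 d0 tx); set n := Num.bound _ => nP.
  have := Ft n I; rewrite /F /= in_itv/= => /andP[_].
  rewrite -ltrBlDl ltr_pdivlMr// -[_ * _%:R]mulrC -ltr_pdivlMr// => /lt_trans/(_ nP).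
  by rewrite ltr_nat ltnNge leqnSn.
move=> n1 n2 n12; apply/subsetPset => t; rewrite /F /= !in_itv/= => /andP[-> /lt_le_trans]; apply.
by rewrite lerD2l ler_pM2l// lef_pV2 ?posrE// ler_nat.
Qed.

Lemma measure_small_left (x d e : R) : 0 < d -> 0 < e ->
  (m `](x - d)%R, x[%classic < +oo)%E ->
  exists2 d', 0 < d' & (m `](x - d')%R, x[%classic <= e%:E)%E.
Proof.
move=> d0 e0 fin; pose F n : set R := `](x - d / n.+1%:R), x[%classic.
have dn n : 0 < d / n.+1%:R by rewrite divr_gt0.
have [n Fn] : exists n, (m (F n) <= e%:E)%E; last by exists (d / n.+1%:R).
apply: measure_small => //; first by rewrite /F divr1.
  by move=> n; exact: measurable_itv.
  apply/seteqP; split=> // t Ft.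
  have := Ft 0%N I; rewrite /F /= in_itv/= => /andP[_ tx'].
  have tx : 0 < x - t by rewrite subr_gt0.
  have /archi_boundP := ltW (divr_gt0 d0 tx); set n := Num.bound _ => nP.
  have := Ft n I; rewrite /F /= in_itv/= => /andP[+ _].
  rewrite ltrBlDr -ltrBlDl ltr_pdivlMr// -[_ * _%:R]mulrC -ltr_pdivlMr// => /lt_trans/(_ nP).
  by rewrite ltr_nat ltnNge leqnSn.
move=> n1 n2 n12; apply/subsetPset => t; rewrite /F /= !in_itv/= => /andP[+ ->].
rewrite andbT; apply: le_lt_trans.
by rewrite lerD2l lerN2 ler_pM2l// lef_pV2 ?posrE// ler_nat.
Qed.

End PositiveMeasure.

(** * Integrals against a locally finite complex measure *)

Section AlternatingSums.
Variable R : realDomainType.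
Implicit Types p q r s : R.

Lemma normr_alt4 p q r s : `|p - q - r + s| <= `|p| + `|q| + `|r| + `|s|.
Proof.
apply: le_trans (ler_normD _ _) _; rewrite lerD2r.
by apply: le_trans (ler_normB _ _) _; rewrite lerD2r ler_normB.
Qed.

Lemma normr_alt4' p q r s : `|p - q + r - s| <= `|p| + `|q| + `|r| + `|s|.
Proof.
apply: le_trans (ler_normB _ _) _; rewrite lerD2r.
by apply: le_trans (ler_normD _ _) _; rewrite lerD2r ler_normB.
Qed.

End AlternatingSums.

(** * The l1 norm on the complex plane *)

Section ComplexSize.
Variable R : realType.
Implicit Types w : R[i].

(** This norm is submultiplicative, takes values in [R], where [lra] applies, and is the integrand
    used in [L1loc]. *)
Definition cn w : R := `|complex.Re w| + `|complex.Im w|.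

Lemma cn_ge0 w : 0 <= cn w. Proof. exact: addr_ge0. Qed.

Lemma cn_eq0 w : cn w <= 0 -> w = 0.
Proof.
case: w => x y; rewrite /cn /= => h.
have x0 := normr_ge0 x; have y0 := normr_ge0 y.
have /normr0_eq0 -> : `|x| = 0 by lra.
by have /normr0_eq0 -> : `|y| = 0 by lra.
Qed.

Lemma cnD w1 w2 : cn (w1 + w2) <= cn w1 + cn w2.
Proof.
case: w1 w2 => [x y] [x' y']; rewrite /cn /= addrACA.
by apply: lerD; exact: ler_normD.
Qed.

Lemma cnN w : cn (- w) = cn w.
Proof. by case: w => x y; rewrite /cn /= !normrN. Qed.

Lemma cnB w1 w2 : cn (w1 - w2) <= cn w1 + cn w2.
Proof. by rewrite -(cnN w2); exact: cnD. Qed.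

Lemma cnM w1 w2 : cn (w1 * w2) <= cn w1 * cn w2.
Proof.
case: w1 w2 => [x y] [x' y']; rewrite /cn /=.
have := ler_normB (x * x') (y * y'); have := ler_normD (x * y') (y * x').
rewrite !normrM; lra.
Qed.

End ComplexSize.

(** * Linearity, additivity and estimates of complex integrals *)

Section ComplexMeasure.
Variables (R : realType) (a b : \bar R).
Notation I := (Iab a b).
Implicit Types (mu : lfcm a b) (A : set R) (f h : R -> R[i]).

Lemma Iab_interval (x y t : R) : I x -> I y -> x <= t <= y -> I t.
Proof.
move=> [ax _] [_ yb] /andP[xt ty]; split.
  by apply: lt_le_trans ax _; rewrite lee_fin.
by apply: le_lt_trans yb; rewrite lee_fin.
Qed.

Lemma subset_Iab (x y : R) : I x -> I y -> `[x, y]%classic `<=` I.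
Proof. by move=> Ix Iy t; rewrite /= in_itv/= => h; exact: Iab_interval h. Qed.

Lemma measurable_Iab : measurable I.
Proof.
apply: is_interval_measurable => x y Ix Iy t h; exact: Iab_interval h.
Qed.

Definition cpart mu (i j : bool) : {measure set R -> \bar R} :=
  if i then if j then cm1 mu else cm2 mu else if j then cm3 mu else cm4 mu.

Lemma cpart_fin mu i j al be : I al -> I be ->
  (cpart mu i j `[al, be]%classic < +oo)%E.
Proof.
by case: i j => -[] Ial Ibe; [exact: cm1_fin|exact: cm2_fin|exact: cm3_fin|exact: cm4_fin].
Qed.

(** These are the sets on which all components are finite and [cmeas] and [cint] have their intended
    meaning. *)
Definition rcompact A := measurable A /\
  exists al be, [/\ I al, I be & A `<=` `[al, be]%classic].

Lemma rcompact_fin mu i j A : rcompact A -> (cpart mu i j A < +oo)%E.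
Proof.
move=> [mA [al [be [Ial Ibe sub]]]]; apply: le_lt_trans (cpart_fin mu i j Ial Ibe).
by apply: le_measure => //; rewrite inE.
Qed.

Lemma rcompactS A (B : set R) : measurable B -> B `<=` A -> rcompact A -> rcompact B.
Proof.
move=> mB BA [_ [al [be [Ial Ibe sub]]]]; split=> //; exists al, be; split=> //.
exact: subset_trans sub.
Qed.

Lemma rcompact_itv (x y : R) (p q : bool) : I x -> I y ->
  rcompact [set` Interval (BSide p x) (BSide q y)].
Proof.
move=> Ix Iy; split=> //; exists x, y; split=> // t; rewrite /= !in_itv/=.
by move=> /andP[/lteifW -> /lteifW ->].
Qed.

Definition cintegrable mu A h := forall i j,
  (cpart mu i j).-integrable A (EFin \o (fun x => complex.Re (h x))) /\
  (cpart mu i j).-integrable A (EFin \o (fun x => complex.Im (h x))).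

(** The real and imaginary parts are each dominated by the integrand of [L1loc], which in turn is
    the sum of their absolute values. *)
Lemma L1locP mu h : L1loc mu h <->
  [/\ measurable_fun I (fun x => complex.Re (h x)),
      measurable_fun I (fun x => complex.Im (h x)) &
      forall al be, I al -> I be -> cintegrable mu `[al, be]%classic h].
Proof.
split=> -[mr mi H]; split=> // al be Ial Ibe.
  have mr' : measurable_fun `[al, be]%classic (fun x => complex.Re (h x)).
    by apply: measurable_funS mr; [exact: measurable_Iab|exact: subset_Iab].
  have mi' : measurable_fun `[al, be]%classic (fun x => complex.Im (h x)).
    by apply: measurable_funS mi; [exact: measurable_Iab|exact: subset_Iab].
  have aux (m : {measure set R -> \bar R}) : ((\int[m]_(x in `[al, be]%classic)
      (`|complex.Re (h x)| + `|complex.Im (h x)|)%:E) < +oo)%E ->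
      m.-integrable `[al, be]%classic (EFin \o (fun x => complex.Re (h x))) /\
      m.-integrable `[al, be]%classic (EFin \o (fun x => complex.Im (h x))).
    move=> fin; have iN : m.-integrable `[al, be]%classic
        (EFin \o (fun x => `|complex.Re (h x)| + `|complex.Im (h x)|)).
      apply/integrableP; split.
        apply/measurable_EFinP; apply: measurable_funD; exact: measurableT_comp.
      by under eq_integral => x _ do rewrite /= ger0_norm ?addr_ge0//.
    split; apply: (le_integrable _ _ _ iN) => //=; try exact/measurable_EFinP.
      by move=> x _; rewrite lee_fin [leRHS]ger0_norm ?addr_ge0// lerDl.
    by move=> x _; rewrite lee_fin [leRHS]ger0_norm ?addr_ge0// lerDr.
  by have [H1 H2 H3 H4] := H _ _ Ial Ibe => -[] []; apply: aux.
have aux i j : ((\int[cpart mu i j]_(x in `[al, be]%classic)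
      (`|complex.Re (h x)| + `|complex.Im (h x)|)%:E) < +oo)%E.
  have [ir ii] := H _ _ Ial Ibe i j.
  have [ir' ii'] : (cpart mu i j).-integrable `[al, be]%classic
     (EFin \o (fun x => `|complex.Re (h x)|)) /\
     (cpart mu i j).-integrable `[al, be]%classic
     (EFin \o (fun x => `|complex.Im (h x)|)).
    by split; [exact: integrable_abse ir|exact: integrable_abse ii].
  have mab : measurable (`[al, be]%classic : set R) by exact: measurable_itv.
  have /integrableP[_] := integrableD mab ir' ii'.
  by under eq_integral => x _ do rewrite /= ger0_norm ?addr_ge0//.
move=> nh; split.
- exact: (aux true true).
- exact: (aux true false).
- exact: (aux false true).
- exact: (aux false false).
Qed.

Lemma L1loc_integrable mu h A : L1loc mu h -> rcompact A -> cintegrable mu A h.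
Proof.
move=> /L1locP[_ _ H] [mA [al [be [Ial Ibe sub]]]] i j.
by have [ir ii] := H _ _ Ial Ibe i j; split; apply: integrableS sub _.
Qed.

Lemma cintegrable_lin mu A (w : R[i]) h f : measurable A ->
  cintegrable mu A h -> cintegrable mu A f ->
  cintegrable mu A (fun x => w * h x + f x).
Proof.
move=> mA H F i j; have [hr hi] := H i j; have [fr fi] := F i j; case: w => p q; split.
- have := integrable_lin p (- q) mA hr hi fr; apply: eq_integrable => // x _ /=.
  by case: (h x) (f x) => [? ?] [? ?] /=; congr EFin; ring.
- have := integrable_lin p q mA hi hr fi; apply: eq_integrable => // x _ /=.
  by case: (h x) (f x) => [? ?] [? ?] /=; congr EFin; ring.
Qed.

Lemma cint_lin mu A (w : R[i]) h f : measurable A ->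
  cintegrable mu A h -> cintegrable mu A f ->
  cint mu A (fun x => w * h x + f x) = w * cint mu A h + cint mu A f.
Proof.
move=> mA H F; case: w => p q.
have L i j : Rintegral (cpart mu i j) A (fun x => complex.Re ((p +i* q)%C * h x + f x)) =
      p * Rintegral (cpart mu i j) A (fun x => complex.Re (h x))
      + (- q) * Rintegral (cpart mu i j) A (fun x => complex.Im (h x))
      + Rintegral (cpart mu i j) A (fun x => complex.Re (f x)) /\
    Rintegral (cpart mu i j) A (fun x => complex.Im ((p +i* q)%C * h x + f x)) =
      p * Rintegral (cpart mu i j) A (fun x => complex.Im (h x))
      + q * Rintegral (cpart mu i j) A (fun x => complex.Re (h x))
      + Rintegral (cpart mu i j) A (fun x => complex.Im (f x)).
  have [hr hi] := H i j; have [fr fi] := F i j.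
  rewrite -!Rintegral_lin//; split; apply: eq_Rintegral => x _;
    by case: (h x) (f x) => [? ?] [? ?] /=; ring.
rewrite /cint.
have /= [-> ->] := L true true; have /= [-> ->] := L true false.
have /= [-> ->] := L false true; have /= [-> ->] := L false false.
by apply/eqP; rewrite eq_complex /=; apply/andP; split; apply/eqP; ring.
Qed.

Lemma eq_cint mu A f h : (forall x, A x -> f x = h x) -> cint mu A f = cint mu A h.
Proof.
move=> fh; have E (m : {measure set R -> \bar R}) (p : R[i] -> R) :
    Rintegral m A (fun x => p (f x)) = Rintegral m A (fun x => p (h x)).
  by apply: eq_Rintegral => x; rewrite inE => /fh ->.
by rewrite /cint !(E _ (@complex.Re R)) !(E _ (@complex.Im R)).
Qed.

Lemma cint0 mu A : cint mu A (fun=> 0) = 0.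
Proof.
have r0 (m : {measure set R -> \bar R}) : Rintegral m A (fun=> 0) = 0.
  by rewrite /Rintegral integral0.
by rewrite /cint /= !r0 !(subr0, addr0).
Qed.

Lemma cintegrable0 mu A : cintegrable mu A (fun=> 0).
Proof. by move=> i j; split; exact: integrable0. Qed.

Lemma cintB mu A h f : measurable A -> cintegrable mu A h -> cintegrable mu A f ->
  cint mu A (fun x => h x - f x) = cint mu A h - cint mu A f.
Proof.
move=> mA H F; have := cint_lin (- 1) mA F H; rewrite mulN1r addrC => <-.
by apply: eq_cint => x _; rewrite mulN1r addrC.
Qed.

Lemma cintU mu A (B : set R) h : measurable A -> measurable B -> (forall x, A x -> ~ B x) ->
  cintegrable mu (A `|` B) h -> cint mu (A `|` B) h = cint mu A h + cint mu B h.
Proof.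
move=> mA mB AB H.
have dAB : [disjoint A & B] by apply/disj_setPS => x [/AB].
have L i j : Rintegral (cpart mu i j) (A `|` B) (fun x => complex.Re (h x)) =
      Rintegral (cpart mu i j) A (fun x => complex.Re (h x)) +
      Rintegral (cpart mu i j) B (fun x => complex.Re (h x)) /\
    Rintegral (cpart mu i j) (A `|` B) (fun x => complex.Im (h x)) =
      Rintegral (cpart mu i j) A (fun x => complex.Im (h x)) +
      Rintegral (cpart mu i j) B (fun x => complex.Im (h x)).
  by have [hr hi] := H i j; split; exact: Rintegral_setU.
rewrite /cint.
have /= [-> ->] := L true true; have /= [-> ->] := L true false.
have /= [-> ->] := L false true; have /= [-> ->] := L false false.
by apply/eqP; rewrite eq_complex /=; apply/andP; split; apply/eqP; ring.
Qed.

Lemma cint_set0 mu h : cint mu set0 h = 0.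
Proof. by rewrite /cint !Rintegral_set0 !(subr0, addr0). Qed.

Lemma cint_set1 mu h (x : R) : cint mu [set x] h = cmeas mu [set x] * h x.
Proof.
rewrite /cint !Rintegral_set1E /cmeas; case: (h x) => p q /=.
by apply/eqP; rewrite eq_complex /=; apply/andP; split; apply/eqP; ring.
Qed.

(** A real-valued form of [tv], meaningful on [rcompact] sets; elsewhere [fine] may turn an infinite
    value into 0. *)
Definition tvr mu A : R := fine (cm1 mu A) + fine (cm2 mu A) + fine (cm3 mu A) + fine (cm4 mu A).

Lemma le_tvr mu A (B : set R) : measurable A -> rcompact B -> A `<=` B -> tvr mu A <= tvr mu B.
Proof.
move=> mA cB AB; have mB := cB.1.
have L i j : fine (cpart mu i j A) <= fine (cpart mu i j B).
  have cA := rcompactS mA AB cB.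
  apply: fine_le; last by apply: le_measure => //; rewrite inE.
  - by rewrite ge0_fin_numE//; exact: rcompact_fin.
  - by rewrite ge0_fin_numE//; exact: rcompact_fin.
by rewrite /tvr !lerD//; [exact: (L true true)|exact: (L true false)
  |exact: (L false true)|exact: (L false false)].
Qed.

(** Each component meets [Re h] once and [Im h] once in the two coordinates of the integral, so the
    joint estimate of both parts gives the constant 1. *)
Lemma cint_bound mu A h (B : R) : rcompact A -> cintegrable mu A h ->
  (forall x, A x -> cn (h x) <= B) -> cn (cint mu A h) <= B * tvr mu A.
Proof.
move=> cA H hB; have mA := cA.1.
have L i j : `|Rintegral (cpart mu i j) A (fun x => complex.Re (h x))| +
    `|Rintegral (cpart mu i j) A (fun x => complex.Im (h x))| <= B * fine (cpart mu i j A).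
  by have [hr hi] := H i j; apply: normr_Rintegral2_le => //; exact: rcompact_fin.
have := L true true; have := L true false; have := L false true; have := L false false.
rewrite /cn /tvr /cint /= => l1 l2 l3 l4.
apply: le_trans (lerD (normr_alt4 _ _ _ _) (normr_alt4' _ _ _ _)) _.
by rewrite !mulrDr; lra.
Qed.

Lemma null_eq_cint mu A (N : set R) h f : measurable A -> measurable N -> tv mu N = 0%E ->
  cintegrable mu A h -> cintegrable mu A f ->
  (forall x, A x -> ~ N x -> h x = f x) -> cint mu A h = cint mu A f.
Proof.
move=> mA mN N0 H F hf.
(* [tv mu N] is a sum of four nonnegative terms, so each of them vanishes. *)
have N0' i j : cpart mu i j N = 0%E.
  apply/eqP; rewrite eq_le measure_ge0 andbT -[leRHS]N0 /tv.
  have m1 := measure_ge0 (cm1 mu) N; have m2 := measure_ge0 (cm2 mu) N.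
  have m3 := measure_ge0 (cm3 mu) N; have m4 := measure_ge0 (cm4 mu) N.
  case: i j => -[] /=.
  - by rewrite -!addeA leeDl// !adde_ge0.
  - by rewrite -addeA [X in (_ <= X + _)%E]addeC -addeA leeDl// !adde_ge0.
  - by rewrite -addeA addeC -addeA leeDl// !adde_ge0.
  - by rewrite leeDr// !adde_ge0.
have L i j : Rintegral (cpart mu i j) A (fun x => complex.Re (h x)) =
      Rintegral (cpart mu i j) A (fun x => complex.Re (f x)) /\
    Rintegral (cpart mu i j) A (fun x => complex.Im (h x)) =
      Rintegral (cpart mu i j) A (fun x => complex.Im (f x)).
  have [hr hi] := H i j; have [fr fi] := F i j.
  by split; apply: (null_eq_Rintegral mA mN (N0' i j)) => // x Ax Nx; rewrite hf.
rewrite /cint.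
have /= [-> ->] := L true true; have /= [-> ->] := L true false.
by have /= [-> ->] := L false true; have /= [-> ->] := L false false.
Qed.

Definition cmeasurable (D : set R) f := measurable_fun D (fun x => complex.Re (f x)) /\
  measurable_fun D (fun x => complex.Im (f x)).

Lemma cmeasurable_cint_lt mu A h : measurable A -> cintegrable mu A h ->
  cmeasurable setT (fun x => cint mu (A `&` `]-oo, x[%classic) h).
Proof.
move=> mA H.
have [h1 h1'] := H true true; have [h2 h2'] := H true false.
have [h3 h3'] := H false true; have [h4 h4'] := H false false.
by split; repeat first [apply: measurable_funB|apply: measurable_funD
  |exact: measurable_Rintegral_lt].
Qed.

Lemma cmeasurable_cst (D : set R) w : cmeasurable D (fun=> w).
Proof. by split; exact: measurable_cst. Qed.

Lemma cmeasurable_lin (D : set R) (w : R[i]) h f :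
  cmeasurable D h -> cmeasurable D f -> cmeasurable D (fun x => w * h x + f x).
Proof.
move=> [hr hi] [fr fi]; case: w => p q; split.
- rewrite (_ : (fun x => _) = (fun x => p * complex.Re (h x) +
     (- q) * complex.Im (h x) + complex.Re (f x))).
    by do 2 ?apply: measurable_funD => //; apply: measurable_funM.
  by apply/funext => x; case: (h x) (f x) => [? ?] [? ?] /=; ring.
- rewrite (_ : (fun x => _) = (fun x => p * complex.Im (h x) +
     q * complex.Re (h x) + complex.Im (f x))).
    by do 2 ?apply: measurable_funD => //; apply: measurable_funM.
  by apply/funext => x; case: (h x) (f x) => [? ?] [? ?] /=; ring.
Qed.

End ComplexMeasure.

(** * Locally bounded measurable functions and primitives *)

Section LocallyBounded.
Variables (R : realType) (a b : \bar R).
Notation I := (Iab a b).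
Implicit Types (mu : lfcm a b) (A : set R) (f h u v g : R -> R[i]).

Lemma Iab_open (x : R) : I x ->
  exists2 d, 0 < d & forall y, x - d <= y <= x + d -> I y.
Proof.
move=> [ax xb]; have [d H] := lt_ereal_nbhs ax xb.
exists (d%:num / 2) => [|y /andP[xy yx]]; first by rewrite divr_gt0.
have d0 : 0 < d%:num by [].
by apply/andP; apply: H; rewrite ltr_norml; apply/andP; split; lra.
Qed.

Lemma measurable_fun_exhaust (f : R -> R) :
  (forall x y, I x -> I y -> measurable_fun `[x, y]%classic f) ->
  measurable_fun I f.
Proof.
move=> mf _ Y mY.
(* [(a, b)] is a countable union of compact intervals with rational end points. *)
pose E (p q : rat) : set R := [set t | I (ratr p) /\ I (ratr q)] `&`
  (`[ratr p, ratr q]%classic `&` f @^-1` Y).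
have mE p q : measurable (E p q).
  have [Ipq|nI] := pselect (I (ratr p) /\ I (ratr q)).
    rewrite /E (_ : [set t | _] = setT) ?setTI; last by apply/seteqP; split.
    by have [Ip Iq] := Ipq; exact: (mf _ _ Ip Iq (measurable_itv _) Y mY).
  by rewrite /E (_ : [set t | _] = set0) ?set0I//; apply/seteqP; split.
rewrite (_ : _ `&` _ = \bigcup_p \bigcup_q E p q).
  by do 2 apply: bigcupT_measurable_rat => ?.
apply/seteqP; split => [t [It Yt]|t [p _ [q _ [[Ip Iq] [pq Yt]]]]]; last first.
  by split=> //; apply: (subset_Iab Ip Iq).
have [d d0 H] := Iab_open It.
have [p] : exists p : rat, ratr p \in `]t - d, t[ by apply: rat_in_itvoo; lra.
have [q] : exists q : rat, ratr q \in `]t, t + d[ by apply: rat_in_itvoo; lra.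
rewrite !in_itv/= => /andP[tq qd] /andP[dp pt].
exists p => //; exists q => //; split; first by split; apply: H; lra.
by split=> //=; rewrite in_itv/=; lra.
Qed.

(** The class in which solutions and quasi-derivatives live. Its members are in [L1loc] for every
    measure at once, so [u] can be integrated against [rho] and [chi], and [v] against [sig]. *)
Definition lbm f := cmeasurable I f /\
  forall x y, I x -> I y -> exists B, forall t, x <= t <= y -> cn (f t) <= B.

Lemma lbm_cst w : lbm (fun=> w).
Proof. by split; [exact: cmeasurable_cst|exists (cn w)]. Qed.

Lemma lbm_lin (w : R[i]) f h : lbm f -> lbm h -> lbm (fun x => w * f x + h x).
Proof.
move=> [mf bf] [mh bh]; split; first exact: cmeasurable_lin.
move=> x y Ix Iy; have [B HB] := bf _ _ Ix Iy; have [C HC] := bh _ _ Ix Iy.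
exists (cn w * B + C) => t xty; apply: le_trans (cnD _ _) _; apply: lerD; last exact: HC.
by apply: le_trans (cnM _ _) _; apply: ler_wpM2l; [exact: cn_ge0|exact: HB].
Qed.

Lemma lbmB f h : lbm f -> lbm h -> lbm (fun x => f x - h x).
Proof.
move=> lf lh; have := lbm_lin (- 1) lh lf.
by rewrite (_ : (fun x => - 1 * _ + _) = (fun x => f x - h x))//; apply/funext => x; ring.
Qed.

(** Measurability and local boundedness can be tested on compact subintervals, with a comparison
    function that depends on the subinterval. *)
Lemma lbm_exhaust f :
  (forall x y, I x -> I y -> x <= y -> exists2 h, lbm h & forall t, x <= t <= y -> f t = h t) ->
  lbm f.
Proof.
move=> H.
have mf (p : R[i] -> R) : (forall h, lbm h -> measurable_fun I (fun x => p (h x))) ->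
    measurable_fun I (fun x => p (f x)).
  move=> Hp; apply: measurable_fun_exhaust => x y Ix Iy.
  have [xy|yx] := leP x y; last by rewrite set_itv_ge -?leNgt ?bnd_simp -?ltNge//; exact: measurable_fun_set0.
  have [h lh fh] := H _ _ Ix Iy xy.
  apply: (@eq_measurable_fun _ _ _ _ _ (fun x => p (h x))).
    by move=> t; rewrite inE/= in_itv/= => /fh ->.
  by apply: measurable_funS (Hp _ lh); [exact: measurable_Iab|exact: subset_Iab].
split; first by split; apply: mf => h [[]].
move=> x y Ix Iy; have [xy|yx] := leP x y; last first.
  by exists 0 => t /andP[xt ty]; move: yx; rewrite ltNge (le_trans xt ty).
have [h [_ bh] fh] := H _ _ Ix Iy xy; have [B HB] := bh _ _ Ix Iy.
by exists B => t xty; rewrite fh ?HB.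
Qed.

Lemma lbm_if f h (e : R) : lbm f -> lbm h -> lbm (fun x => if x <= e then f x else h x).
Proof.
move=> [[fr fi] bf] [[hr hi] bh].
have me : measurable_fun I (fun x : R => x <= e).
  by apply: measurable_funTS; exact: measurable_fun_ler.
split; [split|].
- rewrite (_ : (fun x => _) = (fun x => if x <= e then complex.Re (f x) else complex.Re (h x))).
    apply: measurable_fun_if => //; first exact: measurable_Iab.
    + by apply: measurable_funS fr; [exact: measurable_Iab|move=> x []].
    + by apply: measurable_funS hr; [exact: measurable_Iab|move=> x []].
  by apply/funext => x; case: ifP.
- rewrite (_ : (fun x => _) = (fun x => if x <= e then complex.Im (f x) else complex.Im (h x))).
    apply: measurable_fun_if => //; first exact: measurable_Iab.
    + by apply: measurable_funS fi; [exact: measurable_Iab|move=> x []].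
    + by apply: measurable_funS hi; [exact: measurable_Iab|move=> x []].
  by apply/funext => x; case: ifP.
move=> x y Ix Iy; have [B HB] := bf _ _ Ix Iy; have [C HC] := bh _ _ Ix Iy.
exists (Num.max B C) => t xty; rewrite le_max; case: ifP => _; first by rewrite HB.
by rewrite HC ?orbT.
Qed.

Lemma lbm_L1loc mu f : lbm f -> L1loc mu f.
Proof.
move=> [[fr fi] bf]; apply/L1locP; split=> // x y Ix Iy i j.
have sub := subset_Iab Ix Iy; have [B HB] := bf _ _ Ix Iy.
split; apply: measurable_bounded_integrable; try exact: measurable_itv;
  try exact: cpart_fin.
- by apply: measurable_funS fr => //; exact: measurable_Iab.
- exists B; split=> [|C BC t /=]; first exact: num_real.
  rewrite in_itv/= => /HB; rewrite /cn; have := normr_ge0 (complex.Im (f t)); lra.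
- by apply: measurable_funS fi => //; exact: measurable_Iab.
- exists B; split=> [|C BC t /=]; first exact: num_real.
  rewrite in_itv/= => /HB; rewrite /cn; have := normr_ge0 (complex.Re (f t)); lra.
Qed.

Lemma L1loc_lin mu (w : R[i]) f h : L1loc mu f -> L1loc mu h -> L1loc mu (fun x => w * f x + h x).
Proof.
move=> /L1locP[fr fi Hf] /L1locP[hr hi Hh]; apply/L1locP.
have [] := @cmeasurable_lin _ I w f h => // mr mi.
by split=> // x y Ix Iy; apply: cintegrable_lin; [exact: measurable_itv|exact: Hf|exact: Hh].
Qed.

Lemma cint_itvD mu h (x y z : R) : L1loc mu h -> I x -> I z -> x <= y -> y <= z ->
  cint mu `[x, z[%classic h = cint mu `[x, y[%classic h + cint mu `[y, z[%classic h.
Proof.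
move=> Lh Ix Iz xy yz.
have E : `[x, z[%classic = `[x, y[%classic `|` `[y, z[%classic.
  by rewrite [LHS](@itv_bndbnd_setU _ _ _ (BLeft y))// bnd_simp.
rewrite E cintU; try exact: measurable_itv.
- by [].
- by move=> t /=; rewrite !in_itv/= => /andP[_ ty] /andP[yt _]; move: ty; rewrite ltNge yt.
- by rewrite -E; apply: L1loc_integrable => //; exact: rcompact_itv.
Qed.

Lemma cint_itvxx mu h (x : R) : cint mu `[x, x[%classic h = 0.
Proof. by rewrite set_itvco0 cint_set0. Qed.

Lemma cint_from_ge mu h (c x : R) : c <= x -> cint_from mu c x h = cint mu `[c, x[%classic h.
Proof.
by rewrite /cint_from le_eqVlt => /predU1P[<-|->//]; rewrite ltxx eqxx cint_itvxx.
Qed.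

Lemma cint_from_le mu h (c x : R) : x <= c -> cint_from mu c x h = - cint mu `[x, c[%classic h.
Proof.
rewrite /cint_from le_eqVlt => /predU1P[->|xc]; first by rewrite ltxx eqxx cint_itvxx oppr0.
by rewrite ltNge ltW//= lt_eqF.
Qed.

(** The base point drops out of increments; this is what frees the system from the base points in
    the definition of a solution. *)
Lemma cint_fromB mu h (c x y : R) : L1loc mu h -> I c -> I x -> I y -> x <= y ->
  cint_from mu c y h - cint_from mu c x h = cint mu `[x, y[%classic h.
Proof.
move=> Lh Ic Ix Iy xy; have [cx|xc] := leP c x.
  rewrite !cint_from_ge ?(le_trans cx xy)// (@cint_itvD mu h c x y)//; ring.
have [cy|yc] := leP c y.
  rewrite (cint_from_ge _ _ cy) (cint_from_le _ _ (ltW xc)) (@cint_itvD mu h x c y)//; last exact: ltW.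
  ring.
rewrite !cint_from_le; try exact: ltW.
rewrite (@cint_itvD mu h x y c)//; last exact: ltW.
ring.
Qed.

Lemma cint_fromE mu f h (c x : R) :
  (forall x y, I x -> I y -> x <= y -> f y - f x = cint mu `[x, y[%classic h) ->
  I c -> I x -> f x = f c + cint_from mu c x h.
Proof.
move=> H Ic Ix; have [cx|xc] := leP c x.
  by rewrite cint_from_ge// -H//; ring.
by rewrite cint_from_le ?ltW// -H// ?ltW//; ring.
Qed.

(** For each component, the integral of the absolute value over [A] bounds the integral over every
    measurable subset. *)
Lemma cint_sub_bound mu A h : measurable A -> cintegrable mu A h ->
  exists B, forall A', measurable A' -> A' `<=` A -> cn (cint mu A' h) <= B.
Proof.
move=> mA H.
have L (m : {measure set R -> \bar R}) (f : R -> R) : m.-integrable A (EFin \o f) ->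
    exists B, forall A', measurable A' -> A' `<=` A -> `|Rintegral m A' f| <= B.
  move=> iF; exists (Rintegral m A (fun x => `|f x|)) => A' mA' sub.
  have iF' := integrableS mA mA' sub iF.
  apply: le_trans (le_normr_Rintegral mA' iF') _.
  have [n1 n2] : m.-integrable A (EFin \o (fun x => `|f x|)) /\
      m.-integrable A' (EFin \o (fun x => `|f x|)).
    by split; [exact: integrable_abse iF|exact: integrable_abse iF'].
  apply: fine_le; try exact: integrable_fin_num.
  apply: ge0_subset_integral => //.
  by have /integrableP[] := n1.
have [h1 h1'] := H true true; have [h2 h2'] := H true false.
have [h3 h3'] := H false true; have [h4 h4'] := H false false.
have [B1 H1] := L _ _ h1; have [B2 H2] := L _ _ h2.
have [B3 H3] := L _ _ h3; have [B4 H4] := L _ _ h4.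
have [C1 K1] := L _ _ h1'; have [C2 K2] := L _ _ h2'.
have [C3 K3] := L _ _ h3'; have [C4 K4] := L _ _ h4'.
exists ((B1 + B2 + C3 + C4) + (C1 + C2 + B3 + B4)) => A' mA' sub.
rewrite /cn /cint /=; apply: lerD.
- apply: le_trans (normr_alt4 _ _ _ _) _; apply: lerD; [apply: lerD; [apply: lerD|]|];
  [exact: H1|exact: H2|exact: K3|exact: K4].
- apply: le_trans (normr_alt4' _ _ _ _) _; apply: lerD; [apply: lerD; [apply: lerD|]|];
  [exact: K1|exact: K2|exact: H3|exact: H4].
Qed.

Lemma lbm_cint_lt mu A h : rcompact a b A -> cintegrable mu A h ->
  lbm (fun x => cint mu (A `&` `]-oo, x[%classic) h).
Proof.
move=> cA H; have mA := cA.1; split.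
  by have [mr mi] := cmeasurable_cint_lt mA H; split; exact: measurable_funTS.
move=> x y _ _; have [B HB] := cint_sub_bound mA H.
by exists B => t _; apply: HB => //; exact: measurableI.
Qed.

(** On [[x, y]] the function is [f x] plus the integral of [h] over the part of [[x, y[] below [t],
    which is Borel and bounded in [t]. *)
Lemma lbm_primitive mu f h (c : R) : L1loc mu h -> I c ->
  (forall x, I x -> f x = f c + cint_from mu c x h) -> lbm f.
Proof.
move=> Lh Ic Hf; apply: lbm_exhaust => x y Ix Iy xy.
have cxy : rcompact a b `[x, y[%classic by exact: rcompact_itv.
exists (fun t => 1 * f x + cint mu (`[x, y[%classic `&` `]-oo, t[%classic) h).
  apply: lbm_lin; first exact: lbm_cst.
  by apply: lbm_cint_lt => //; exact: L1loc_integrable.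
move=> t xty; have It := Iab_interval Ix Iy xty; have /andP[xt ty] := xty.
rewrite (_ : _ `&` _ = `[x, t[%classic).
  by rewrite -(@cint_fromB mu h c x t)// Hf// (Hf x)//; ring.
apply/seteqP; split=> s /=; rewrite !in_itv/=; first by move=> [/andP[-> _] ->].
by move=> /andP[-> st]; rewrite st (lt_le_trans st ty).
Qed.

End LocallyBounded.

(** * Picard iteration *)

Section Picard.
Variable R : realType.
Implicit Types (f h r : R -> R[i]) (C e : R).

Lemma half_pow_small C e : 0 < e -> exists N, forall n, (N <= n)%N -> C / 2 ^+ n <= e.
Proof.
move=> e0; have [C0|C0] := leP C 0.
  by exists 0%N => n _; apply: le_trans (ltW e0); rewrite pmulr_lle0// invr_gt0 exprn_gt0.
have /archi_boundP := ltW (divr_gt0 C0 e0); set N := Num.bound _ => NP.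
exists N => n Nn; rewrite ler_pdivrMr ?exprn_gt0// mulrC -ler_pdivrMr//.
apply: ltW; apply: lt_le_trans NP _.
by rewrite -natrX ler_nat (leq_trans Nn)// ltnW// ltn_expl.
Qed.

Lemma le0_half_pow C e : (forall n, e <= C / 2 ^+ n) -> e <= 0.
Proof.
move=> H; rewrite leNgt; apply/negP => e0.
have [|N /(_ N (leqnn N))] := @half_pow_small C (e / 2); first by lra.
have := H N; lra.
Qed.

(** With [d n = 2 * C / 2 ^+ n] one has [d n = d n.+1 + C / 2 ^+ n], so the intervals of centre
    [s n] and radius [d n] are nested; the supremum of their left end points lies in all of them. *)
Lemma geometric_limit (s : nat -> R) C : 0 <= C ->
  (forall n, `|s n.+1 - s n| <= C / 2 ^+ n) ->
  exists l, forall n, `|s n - l| <= 2 * C / 2 ^+ n.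
Proof.
move=> C0 H; pose d n := 2 * C / 2 ^+ n.
have d0 n : 0 <= d n by rewrite divr_ge0 ?mulr_ge0// exprn_ge0.
have dS n : d n = d n.+1 + C / 2 ^+ n.
  by rewrite /d exprS invfM; set q := (2 ^+ n)^-1; field.
have dS' n : d n.+1 = C / 2 ^+ n.
  by rewrite /d exprS invfM; set q := (2 ^+ n)^-1; field.
have bnd n k : s n - d n <= s (n + k)%N - d (n + k)%N /\ s (n + k)%N + d (n + k)%N <= s n + d n.
  elim: k => [|k [l1 l2]]; rewrite ?addn0// addnS.
  have := H (n + k)%N; have := dS (n + k)%N; have := dS' (n + k)%N.
  by rewrite ler_norml => e1 e2 /andP[h1 h2]; split; lra.
have LU n m : s n - d n <= s m + d m.
  have [/subnKC <-|/ltnW/subnKC <-] := leqP n m.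
    by have [l1 l2] := bnd n (m - n)%N; have := d0 (n + (m - n))%N; lra.
  by have [l1 l2] := bnd m (n - m)%N; have := d0 (m + (n - m))%N; lra.
pose S := range (fun n => s n - d n).
have S0 : S !=set0 by exists (s 0%N - d 0%N), 0%N.
have Sb : has_ubound S by exists (s 0%N + d 0%N) => _ [n _ <-]; exact: LU.
exists (sup S) => n; rewrite ler_norml.
have l1 : s n - d n <= sup S by apply: ub_le_sup => //; exists n.
have l2 : sup S <= s n + d n by apply: ge_sup => // _ [m _ <-]; exact: LU.
by rewrite -/(d n); apply/andP; split; lra.
Qed.

Lemma geometric_climit (s : nat -> R[i]) C : 0 <= C ->
  (forall n, cn (s n.+1 - s n) <= C / 2 ^+ n) ->
  exists l, forall n, cn (s n - l) <= 4 * C / 2 ^+ n.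
Proof.
move=> C0 H.
have [n|x hx] := @geometric_limit (fun n => complex.Re (s n)) C C0.
  have := H n; rewrite /cn; case: (s n) (s n.+1) => [p q] [p' q'] /=.
  by have := normr_ge0 (q' - q); lra.
have [n|y hy] := @geometric_limit (fun n => complex.Im (s n)) C C0.
  have := H n; rewrite /cn; case: (s n) (s n.+1) => [p q] [p' q'] /=.
  by have := normr_ge0 (p' - p); lra.
exists (Complex x y) => n; have := hx n; have := hy n; rewrite /cn.
by case: (s n) => [p q] /=; lra.
Qed.

(** The iteration runs on the whole line with uniform bounds: the integral operators integrate over
    a fixed bounded set cut at [x], and so make sense for every real [x]. *)
Definition bm f := cmeasurable setT f /\ exists B, forall x, cn (f x) <= B.

Lemma bm_cst w : bm (fun=> w).
Proof. by split; [exact: cmeasurable_cst|exists (cn w)]. Qed.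

Lemma bm_lin (w : R[i]) f h : bm f -> bm h -> bm (fun x => w * f x + h x).
Proof.
move=> [mf [B HB]] [mh [C HC]]; split; first exact: cmeasurable_lin.
exists (cn w * B + C) => x; apply: le_trans (cnD _ _) _; apply: lerD => //.
by apply: le_trans (cnM _ _) _; apply: ler_wpM2l => //; exact: cn_ge0.
Qed.

Lemma bmD f h : bm f -> bm h -> bm (fun x => f x + h x).
Proof.
move=> bf bh; have := bm_lin 1 bf bh.
by rewrite (_ : (fun x => 1 * _ + _) = (fun x => f x + h x))//; apply/funext => x; ring.
Qed.

Lemma bmB f h : bm f -> bm h -> bm (fun x => f x - h x).
Proof.
move=> bf bh; have := bm_lin (- 1) bh bf.
by rewrite (_ : (fun x => - 1 * _ + _) = (fun x => f x - h x))//; apply/funext => x; ring.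
Qed.

(** The iterates from 0 converge geometrically and uniformly, so the limit is bounded, and it is
    Borel as a pointwise limit. *)
Lemma picard (K : (R -> R[i]) -> R -> R[i]) r :
  (forall f, bm f -> bm (K f)) ->
  (forall f h, bm f -> bm h -> forall x, K (fun t => f t - h t) x = K f x - K h x) ->
  (forall f B, bm f -> (forall x, cn (f x) <= B) -> forall x, cn (K f x) <= B / 2) ->
  bm r -> exists2 u, bm u & forall x, u x = r x + K u x.
Proof.
move=> bK KB Khalf br.
pose w := fix w n : R -> R[i] := if n is n'.+1 then (fun x => r x + K (w n') x) else (fun=> 0).
have bw n : bm (w n).
  by elim: n => [|n IH] /=; [exact: bm_cst|apply: bmD => //; exact: bK].
have [_ [B0 HB0]] := bw 1%N.
have B00 : 0 <= B0 by apply: le_trans (HB0 0); exact: cn_ge0.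
have step n : forall x, cn (w n.+1 x - w n x) <= B0 / 2 ^+ n.
  elim: n => [|n IH] x; first by rewrite expr0 divr1 [w 0%N x]/= subr0.
  rewrite [X in cn X](_ : _ = K (w n.+1) x - K (w n) x); last by rewrite /=; ring.
  rewrite -KB// exprS invfM [B0 * _]mulrCA mulrC.
  by apply: Khalf IH x; exact: bmB.
have /choice[u hu] x : exists l, forall n, cn (w n x - l) <= 4 * B0 / 2 ^+ n.
  by apply: (@geometric_climit (fun n => w n x)) => // n; exact: step.
have cvgu (p : R[i] -> R) : (forall t s, `|p t - p s| <= cn (t - s)) ->
    (forall n, measurable_fun setT (fun x => p (w n x))) ->
    measurable_fun setT (fun x => p (u x)).
  move=> pcn mp; apply: (measurable_fun_cvg mp) => x _.
  apply/cvgrPdist_le => e e0.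
  have [N HN] := half_pow_small (4 * B0) e0; exists N => // n /= /HN.
  by apply: le_trans; rewrite distrC; apply: le_trans (pcn _ _) (hu x n).
have bu : bm u.
  split; last first.
    exists (4 * B0) => x; have := hu x 0%N.
    by rewrite expr0 divr1 [w 0%N x]/= sub0r cnN.
  split; apply: cvgu.
  - by move=> [? ?] [? ?]; rewrite /cn /= lerDl.
  - by move=> n; case: (bw n) => -[].
  - by move=> [? ?] [? ?]; rewrite /cn /= lerDr.
  - by move=> n; case: (bw n) => -[].
exists u => // x; apply/eqP; rewrite -subr_eq0; apply/eqP/cn_eq0.
apply: (@le0_half_pow (4 * B0)) => n.
(* The defect of the limit is written through errors of the iterates, both of order [2 ^- n]. *)
have E : u x - (r x + K u x) = K (fun t => w n t - u t) x - (w n.+1 x - u x).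
  by rewrite KB//=; ring.
rewrite E; apply: le_trans (cnB _ _) _.
have h1 := hu x n.+1.
have h2 := Khalf _ _ (bmB (bw n) bu) (fun t => hu t n) x.
by move: h1 h2; rewrite exprS invfM; set q := (2 ^+ n)^-1; lra.
Qed.

End Picard.

(** * The first-order system *)

Section System.
Variables (R : realType) (a b : \bar R) (rho sig chi : lfcm a b).
Notation I := (Iab a b).
Implicit Types (f h u v w g : R -> R[i]) (D : set R) (mu : lfcm a b) (z : R[i]).

(** The first-order system in increments: it needs no base point, restricts to subsets of [D], and
    can be glued. *)
Definition sys z g D u v := forall x y, D x -> D y -> x <= y ->
  u y - u x = cint sig `[x, y[%classic v /\
  v y - v x = cint chi `[x, y[%classic u - z * cint rho `[x, y[%classic u
              - cint rho `[x, y[%classic g.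

Lemma rcompact_integrable mu h A : lbm a b h -> rcompact a b A -> cintegrable mu A h.
Proof. by move=> lh; apply: L1loc_integrable; exact: lbm_L1loc. Qed.

(** The companion [v] is the quasi-derivative. It equals [h] up to a [sig]-null set, and [k] equals
    [z * u + g] up to a [rho]-null set, so the integrals do not change. *)
Lemma is_solution_sys g z (c : R) d1 d2 u : L1loc rho g -> I c ->
  is_solution rho sig chi g z c d1 d2 u ->
  exists v, [/\ lbm a b u, lbm a b v, sys z g I u v, u c = d1 & v c = d2].
Proof.
move=> Lg Ic [c0 [h [F [k [Ic0 [Lh [c1 [Ic1 Hu]]] [Lk [c2 [Ic2 HF]]]
  [N [mN N0 HN]] [[M [mM M0 HM]] uc vc]]]]]].
have lu : lbm a b u by exact: lbm_primitive Hu.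
have lF : lbm a b F by exact: lbm_primitive HF.
have lv : lbm a b (fun x => cint_from chi c0 x u - F x).
  apply: lbmB => //; apply: (@lbm_primitive _ _ _ chi _ u c0) => //; first exact: lbm_L1loc.
  by move=> x Ix; rewrite [X in _ = X + _]cint_from_ge// cint_itvxx add0r.
exists (fun x => cint_from chi c0 x u - F x); split=> // x y Ix Iy xy.
have cxy : rcompact a b `[x, y[%classic by exact: rcompact_itv.
have mxy := cxy.1.
have Ixy t : `[x, y[%classic t -> I t.
  by rewrite /= in_itv/= => /andP[xt /ltW ty]; apply: (Iab_interval Ix Iy); rewrite xt.
split.
- have -> : u y - u x = cint sig `[x, y[%classic h.
    by rewrite -(cint_fromB Lh Ic1 Ix Iy xy) (Hu x)// (Hu y)//; ring.
  apply: (null_eq_cint mxy mN N0) => [||t /Ixy It Nt].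
  + exact: L1loc_integrable.
  + exact: rcompact_integrable.
  + by rewrite (HN _ It Nt); ring.
- have -> : cint_from chi c0 y u - F y - (cint_from chi c0 x u - F x) =
     (cint_from chi c0 y u - cint_from chi c0 x u) - (F y - F x) by ring.
  rewrite cint_fromB//; last exact: lbm_L1loc.
  have -> : F y - F x = cint rho `[x, y[%classic k.
    by rewrite -(cint_fromB Lk Ic2 Ix Iy xy) (HF x)// (HF y)//; ring.
  rewrite (@null_eq_cint _ _ _ _ _ _ k (fun t => z * u t + g t) mxy mM M0).
  + by rewrite cint_lin//; [ring|exact: rcompact_integrable|exact: L1loc_integrable].
  + exact: L1loc_integrable.
  + by apply: cintegrable_lin => //; [exact: rcompact_integrable|exact: L1loc_integrable].
  + by move=> t /Ixy It Mt; rewrite -(HM _ It Mt); ring.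
Qed.

(** With base point [c], derivative [v], [F] the integral of [u] against [chi] minus [v], and
    [k = z * u + g], the almost-everywhere identities hold everywhere, and [F c = - v c]. *)
Lemma sys_is_solution g z (c : R) u v : L1loc rho g -> I c ->
  lbm a b u -> lbm a b v -> sys z g I u v ->
  is_solution rho sig chi g z c (u c) (v c) u.
Proof.
move=> Lg Ic lu lv S.
have ae0 mu (P : R -> Prop) : (forall x, I x -> P x) -> ae mu P.
  by move=> H; exists set0; split=> [||x Ix _]; [|rewrite /tv !measure0 !adde0|exact: H].
exists c, v, (fun x => cint_from chi c x u - v x), (fun x => z * u x + g x); split=> //.
- split; first exact: lbm_L1loc.
  exists c; split=> // x Ix; apply: cint_fromE => // s t Is It st.
  by have [] := S s t Is It st.
- split; first by apply: L1loc_lin => //; exact: lbm_L1loc.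
  exists c; split=> // x Ix; 
  apply: (@cint_fromE _ _ _ _ (fun t => cint_from chi c t u - v t)) => // s t Is It st.
  have cst : rcompact a b `[s, t[%classic by exact: rcompact_itv.
  rewrite cint_lin//; [|exact: rcompact_integrable|exact: L1loc_integrable].
  have [_] := S s t Is It st.
  rewrite -(@cint_fromB _ _ _ chi u c s t)//; last exact: lbm_L1loc.
  move=> E; rewrite (_ : v t = v s + (v t - v s)); last by ring.
  by rewrite E; ring.
- by apply: ae0 => x Ix; ring.
- split; [by apply: ae0 => x Ix; ring|by []|].
  by rewrite cint_from_ge// cint_itvxx; ring.
Qed.

Lemma sys_sub z g D D' u v : D' `<=` D -> sys z g D u v -> sys z g D' u v.
Proof. by move=> DD S x y /DD Dx /DD Dy; exact: S. Qed.

Lemma eq_sys z g D u v u' v' : (forall x y t, D x -> D y -> x <= t <= y -> D t) ->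
  (forall x, D x -> u x = u' x) -> (forall x, D x -> v x = v' x) ->
  sys z g D u v -> sys z g D u' v'.
Proof.
move=> convD uu vv S x y Dx Dy xy; have [S1 S2] := S x y Dx Dy xy.
have Dt t : `[x, y[%classic t -> D t.
  by rewrite /= in_itv/= => /andP[xt /ltW ty]; apply: (convD x y) => //; rewrite xt.
rewrite -!uu// -!vv// S1 S2; split; first by apply: eq_cint => t /Dt; exact: vv.
have e mu : cint mu `[x, y[%classic u = cint mu `[x, y[%classic u'.
  by apply: eq_cint => t /Dt; exact: uu.
by rewrite !e.
Qed.

Lemma sysB z g D u v u' v' : D `<=` I ->
  lbm a b u -> lbm a b v -> lbm a b u' -> lbm a b v' ->
  sys z g D u v -> sys z g D u' v' ->
  sys z (fun=> 0) D (fun x => u x - u' x) (fun x => v x - v' x).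
Proof.
move=> DI lu lv lu' lv' S S' x y Dx Dy xy.
have [S1 S2] := S x y Dx Dy xy; have [S1' S2'] := S' x y Dx Dy xy.
have cxy : rcompact a b `[x, y[%classic by apply: rcompact_itv; exact: DI.
have mxy := cxy.1; split.
- rewrite cintB//; try exact: rcompact_integrable.
  by rewrite -S1 -S1'; ring.
- rewrite cint0 !cintB//; try exact: rcompact_integrable.
  rewrite (_ : _ - _ = (v y - v x) - (v' y - v' x)); last by ring.
  by rewrite S2 S2'; ring.
Qed.

Lemma cint_co_head mu h (x y : R) : L1loc mu h -> I x -> I y -> x < y ->
  cint mu `[x, y[%classic h = cmeas mu [set x] * h x + cint mu `]x, y[%classic h.
Proof.
move=> Lh Ix Iy xy; rewrite -cint_set1.
have E : `[x, y[%classic = [set x] `|` `]x, y[%classic by rewrite setU1itv// bnd_simp.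
rewrite E cintU//.
- by move=> t ->; rewrite /= in_itv/= ltxx.
- by rewrite -E; apply: L1loc_integrable => //; exact: rcompact_itv.
Qed.

(* The right limits of [u] and [v] at [x], up to the contribution of [g]. *)
Definition jump1 (x : R) u v := u x + cmeas sig [set x] * v x.
Definition jump2 z (x : R) u v :=
  v x + (cmeas chi [set x] - z * cmeas rho [set x]) * u x.

(** The values at [e] itself may differ: integrals over [[x, e[] do not see [e], and those over [[e,
    y[] see it only through the atom. It suffices that the right limits agree; the atom of [g]
    contributes equally to both sides. *)
Lemma sys_glue z g D (e : R) u v u' v' : D `<=` I -> D e ->
  lbm a b u -> lbm a b v -> lbm a b u' -> lbm a b v' -> L1loc rho g ->
  sys z g (D `&` [set x | x <= e]) u v ->
  sys z g (D `&` [set x | e <= x]) u' v' ->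
  jump1 e u v = jump1 e u' v' -> jump2 z e u v = jump2 z e u' v' ->
  sys z g D (fun x => if x <= e then u x else u' x) (fun x => if x <= e then v x else v' x).
Proof.
move=> DI De lu lv lu' lv' Lg S S' J1 J2 x y Dx Dy xy.
have Ix := DI _ Dx; have Iy := DI _ Dy; have Ie := DI _ De.
have [ye|ey] := leP y e.
  rewrite (le_trans xy ye).
  have [] := S x y (conj Dx (le_trans xy ye)) (conj Dy ye) xy.
  have eq f h mu : cint mu `[x, y[%classic (fun x => if x <= e then f x else h x) =
      cint mu `[x, y[%classic f.
    apply: eq_cint => t /=; rewrite in_itv/= => /andP[_ ty].
    by rewrite (le_trans (ltW ty) ye).
  by rewrite !eq.
have [xe|ex] := leP x e; last first.
  have [] := S' x y (conj Dx (ltW ex)) (conj Dy (ltW ey)) xy.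
  have eq f h mu : cint mu `[x, y[%classic (fun x => if x <= e then f x else h x) =
      cint mu `[x, y[%classic h.
    apply: eq_cint => t /=; rewrite in_itv/= => /andP[xt _].
    by rewrite leNgt (lt_le_trans ex xt).
  by rewrite !eq.
have eq f h mu : lbm a b f -> lbm a b h ->
    cint mu `[x, y[%classic (fun x => if x <= e then f x else h x) =
    cint mu `[x, e[%classic f + cint mu `[e, y[%classic h + cmeas mu [set e] * (f e - h e).
  move=> lf lh; rewrite (@cint_itvD _ _ _ _ _ x e y)//; last 2 first.
  - by apply: lbm_L1loc; exact: lbm_if.
  - exact: ltW.
  rewrite (cint_co_head (lbm_L1loc mu (lbm_if e lf lh)) Ie Iy ey).
  rewrite (cint_co_head (lbm_L1loc mu lh))//= lexx.
  rewrite (@eq_cint _ _ _ mu `[x, e[%classic _ f); last first.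
    by move=> t /=; rewrite in_itv/= => /andP[_ /ltW ->].
  rewrite (@eq_cint _ _ _ mu `]e, y[%classic _ h); last first.
    by move=> t /=; rewrite in_itv/= => /andP[et _]; rewrite leNgt et.
  by ring.
have [S1 S2] := S x e (conj Dx xe) (conj De (lexx e)) xe.
have [S1' S2'] := S' e y (conj De (lexx e)) (conj Dy (ltW ey)) (ltW ey).
rewrite !eq// (cint_itvD Lg Ix Iy xe (ltW ey)); split.
(* After inserting both systems, the defect of each equation is the difference of the corresponding
   jumps. *)
- rewrite -S1 -S1'; apply/eqP; rewrite -subr_eq0; apply/eqP.
  transitivity (jump1 e u' v' - jump1 e u v); first by rewrite /jump1; ring.
  by rewrite J1 subrr.
- rewrite (_ : v' y - v x = (v' y - v' e) + (v e - v x) + (v' e - v e)); last by ring.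
  rewrite S2 S2'; apply/eqP; rewrite -subr_eq0; apply/eqP.
  transitivity (jump2 z e u' v' - jump2 z e u v); first by rewrite /jump2; ring.
  by rewrite J2 subrr.
Qed.

End System.

(** * Solutions on intervals of small variation *)

Section LocalSolution.
Variables (R : realType) (a b : \bar R) (rho sig chi : lfcm a b).
Notation I := (Iab a b).
Implicit Types (f h u v w g U V : R -> R[i]) (mu : lfcm a b) (z : R[i]).

Lemma bm_lbm f : bm f -> lbm a b f.
Proof.
move=> [[mr mi] [B HB]]; split; first by split; exact: measurable_funTS.
by move=> x y _ _; exists B => t _.
Qed.

Lemma bm_cint_lt mu A h : rcompact a b A -> cintegrable mu A h ->
  bm (fun x => cint mu (A `&` `]-oo, x[%classic) h).
Proof.
move=> cA H; have mA := cA.1; split; first exact: cmeasurable_cint_lt.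
have [B HB] := cint_sub_bound mA H.
by exists B => t; apply: HB => //; exact: measurableI.
Qed.

Lemma rcompactI A (B : set R) : rcompact a b A -> measurable B -> rcompact a b (A `&` B).
Proof.
by move=> cA mB; apply: (rcompactS _ _ cA) => //; apply: measurableI => //; exact: cA.1.
Qed.

Lemma cint_ltB mu A h (x y : R) : rcompact a b A -> L1loc mu h -> x <= y ->
  cint mu (A `&` `]-oo, y[%classic) h - cint mu (A `&` `]-oo, x[%classic) h =
  cint mu (A `&` `[x, y[%classic) h.
Proof.
move=> cA Lh xy; have mA := cA.1.
have E : A `&` `]-oo, y[%classic = (A `&` `]-oo, x[%classic) `|` (A `&` `[x, y[%classic).
  rewrite -setIUr; congr (_ `&` _); apply/seteqP; split=> t /=; rewrite !in_itv/=.
    by move=> ty; case: (ltP t x) => tx; [left|right].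
  by case=> [tx|/andP[]//]; exact: lt_le_trans xy.
rewrite E cintU; first by ring.
- exact: measurableI.
- exact: measurableI.
- by move=> t /= [_]; rewrite !in_itv/= => tx [_ /andP[xt _]]; move: tx; rewrite ltNge xt.
- by rewrite -E; apply: L1loc_integrable => //; exact: rcompactI.
Qed.

(* [sys] on [[al, be]] with the atom at [al] removed from the integrals of the
   unknowns, but kept in the integral of [g]. *)
Definition presys z g (al be : R) U V := forall x y, al <= x -> x <= y -> y <= be ->
  U y - U x = cint sig (`]al, be[%classic `&` `[x, y[%classic) V /\
  V y - V x = cint chi (`]al, be[%classic `&` `[x, y[%classic) U
    - z * cint rho (`]al, be[%classic `&` `[x, y[%classic) U - cint rho `[x, y[%classic g.

(** The operators below are differences of two integrals over subsets of [A], so a quarter for each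
    integral gives the contraction factor one half. *)
Definition small z A := tvr sig A <= 4^-1 /\ tvr chi A + cn z * tvr rho A <= 4^-1.

Lemma cint_bound_sub mu A (A' : set R) f (B : R) : rcompact a b A -> measurable A' ->
  A' `<=` A -> lbm a b f -> 0 <= B -> (forall x, A' x -> cn (f x) <= B) ->
  cn (cint mu A' f) <= B * tvr mu A.
Proof.
move=> cA mA' sub lf B0 fB; have cA' := rcompactS mA' sub cA.
apply: le_trans (cint_bound cA' (rcompact_integrable mu lf cA') fB) _.
by apply: ler_wpM2l => //; exact: le_tvr.
Qed.

(** Primitives are taken from [al] and normalised by subtracting their value at [e], which treats
    points to the left and to the right of [e] alike. *)
Lemma presys_exists z g (al be e : R) (d1 d2 : R[i]) : I al -> I be -> L1loc rho g ->
  small z `]al, be[%classic -> al <= e <= be ->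
  exists U V, [/\ bm U, bm V, presys z g al be U V, U e = d1 & V e = d2].
Proof.
move=> Ial Ibe Lg [sm1 sm2] _.
set E : set R := `]al, be[%classic in sm1 sm2 *.
have cE : rcompact a b E by exact: rcompact_itv.
have cF : rcompact a b `[al, be[%classic by exact: rcompact_itv.
pose A (x : R) : set R := E `&` `]-oo, x[%classic.
have cA x : rcompact a b (A x) by exact: rcompactI.
have mA x : measurable (A x) by exact: (cA x).1.
have ci mu f x : bm f -> cintegrable mu (A x) f.
  by move=> bf; apply: rcompact_integrable => //; exact: bm_lbm.
have bA mu f : bm f -> bm (fun x => cint mu (A x) f).
  by move=> bf; apply: bm_cint_lt => //; apply: rcompact_integrable => //; exact: bm_lbm.
have bd mu f (B : R) x : bm f -> (forall t, cn (f t) <= B) ->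
    cn (cint mu (A x) f) <= B * tvr mu E.
  move=> bf fB; apply: cint_bound_sub => //; first by move=> t [].
  - exact: bm_lbm.
  - by apply: le_trans (fB 0); exact: cn_ge0.
(* [U = d1 + K1 V] and [V = r2 + K2 U]: it suffices to solve
   [U = d1 + K1 r2 + K1 (K2 U)]. *)
pose K1 f := (fun x => cint sig (A x) f - cint sig (A e) f).
pose K2 f := (fun x => ((- z) * cint rho (A x) f + cint chi (A x) f)
                       - ((- z) * cint rho (A e) f + cint chi (A e) f)).
have bK1 f : bm f -> bm (K1 f).
  by move=> bf; apply: bmB; [exact: bA|exact: bm_cst].
have bK2 f : bm f -> bm (K2 f).
  by move=> bf; apply: bmB; [apply: bm_lin; exact: bA|exact: bm_cst].
have K1B f h : bm f -> bm h -> forall x, K1 (fun t => f t - h t) x = K1 f x - K1 h x.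
  by move=> bf bh x; rewrite /K1 !cintB//; try exact: ci; ring.
have K2B f h : bm f -> bm h -> forall x, K2 (fun t => f t - h t) x = K2 f x - K2 h x.
  by move=> bf bh x; rewrite /K2 !cintB//; try exact: ci; ring.
have K1h f (B : R) : bm f -> (forall x, cn (f x) <= B) -> forall x, cn (K1 f x) <= B / 2.
  move=> bf fB x; apply: le_trans (cnB _ _) _.
  have B0 : 0 <= B by apply: le_trans (fB 0); exact: cn_ge0.
  have := bd sig f B x bf fB; have := bd sig f B e bf fB.
  by have := ler_wpM2l B0 sm1; lra.
have K2h f (B : R) : bm f -> (forall x, cn (f x) <= B) -> forall x, cn (K2 f x) <= B / 2.
  move=> bf fB x.
  have B0 : 0 <= B by apply: le_trans (fB 0); exact: cn_ge0.
  have h y : cn ((- z) * cint rho (A y) f + cint chi (A y) f) <=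
      B * (tvr chi E + cn z * tvr rho E).
    apply: le_trans (cnD _ _) _; rewrite mulrDr addrC; apply: lerD; first exact: bd.
    apply: le_trans (cnM _ _) _; rewrite cnN mulrCA.
    by apply: ler_wpM2l; [exact: cn_ge0|exact: bd].
  apply: le_trans (cnB _ _) _; have := h x; have := h e.
  by have := ler_wpM2l B0 sm2; lra.
(* The integral of [g] runs over [[al, be[] and keeps the atom at [al], as [presys] demands. *)
pose r2 := (fun x => d2 - (cint rho (`[al, be[%classic `&` `]-oo, x[%classic) g
                         - cint rho (`[al, be[%classic `&` `]-oo, e[%classic) g)).
have br2 : bm r2.
  apply: bmB; first exact: bm_cst.
  by apply: bmB; [apply: bm_cint_lt => //; exact: L1loc_integrable|exact: bm_cst].
have [] := @picard R (fun f => K1 (K2 f)) (fun x => d1 + K1 r2 x).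
- by move=> f bf; exact/bK1/bK2.
- move=> f h bf bh x.
  have -> : K2 (fun t => f t - h t) = (fun t => K2 f t - K2 h t).
    by apply/funext => t; exact: K2B.
  by apply: K1B; exact: bK2.
- move=> f B bf fB x.
  have B0 : 0 <= B by apply: le_trans (fB 0); exact: cn_ge0.
  apply: le_trans (K1h _ (B / 2) (bK2 _ bf) (K2h _ _ bf fB) x) _.
  by apply: ler_wpM2r => //; lra.
- by apply: bmD; [exact: bm_cst|exact: bK1].
move=> U bU HU; pose V x := r2 x + K2 U x.
have bV : bm V by apply: bmD => //; exact: bK2.
(* Since [V - K2 U = r2], additivity of [K1] turns the fixed-point equation back into the first
   equation of the system. *)
have UE x : U x = d1 + K1 V x.
  rewrite HU -addrA; congr (_ + _).
  have := K1B V (K2 U) bV (bK2 _ bU) x.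
  rewrite (_ : (fun t => V t - K2 U t) = r2) => [->|]; first by ring.
  by apply/funext => t; rewrite /V; ring.
exists U, V; split=> //; last 2 first.
- by rewrite UE /K1; ring.
- by rewrite /V /r2 /K2; ring.
have lU := bm_lbm bU; have lV := bm_lbm bV.
move=> x y alx xy ybe; split.
  rewrite !UE -(cint_ltB cE (lbm_L1loc _ lV) xy) /K1 /A; ring.
rewrite -(cint_ltB cE (lbm_L1loc _ lU) xy) -(cint_ltB cE (lbm_L1loc _ lU) xy).
rewrite (_ : `[x, y[%classic = `[al, be[%classic `&` `[x, y[%classic).
  rewrite -(cint_ltB cF Lg xy) /V /r2 /K2 /A; ring.
apply/seteqP; split=> t /=; rewrite !in_itv/=; last by case.
move=> /andP[xt ty]; rewrite (le_trans alx xt) (lt_le_trans ty ybe) xt ty.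
by [].
Qed.

(** Each application of the integral equations halves a common bound for [U] and [V] on [[al, be]],
    so that bound is 0. *)
Lemma presys0_unique z (al be e : R) U V : I al -> I be -> lbm a b U -> lbm a b V ->
  small z `]al, be[%classic -> al <= e <= be ->
  presys z (fun=> 0) al be U V -> U e = 0 -> V e = 0 ->
  forall x, al <= x <= be -> U x = 0 /\ V x = 0.
Proof.
move=> Ial Ibe lU lV [sm1 sm2] /andP[ale ebe] S Ue Ve.
set E : set R := `]al, be[%classic in sm1 sm2 *.
have cE : rcompact a b E by exact: rcompact_itv.
have [BU HU] := lU.2 _ _ Ial Ibe; have [BV HV] := lV.2 _ _ Ial Ibe.
have al_e : al <= be by exact: le_trans ebe.
pose B := Num.max BU BV.
have B0 : 0 <= B by rewrite le_max (le_trans (cn_ge0 _) (HU al _)) ?lexx.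
have HB x n : al <= x <= be -> cn (U x) <= B / 2 ^+ n /\ cn (V x) <= B / 2 ^+ n.
  elim: n x => [|n IH] x xab.
    by rewrite expr0 divr1 !le_max HU// HV// orbT.
  set C := B / 2 ^+ n in IH *.
  have C0 : 0 <= C by rewrite divr_ge0// exprn_ge0.
  have -> : B / 2 ^+ n.+1 = C / 2 by rewrite /C exprS invfM; set q := (2 ^+ n)^-1; ring.
  have bd mu f (A : set R) : lbm a b f -> (forall t, al <= t <= be -> cn (f t) <= C) ->
     measurable A -> cn (cint mu (E `&` A) f) <= C * tvr mu E.
    move=> lf fC mA; apply: cint_bound_sub => //.
    - by apply: measurableI => //; exact: cE.1.
    - move=> t [+ _]; rewrite /E /= in_itv/= => /andP[alt tbe].
      by apply: fC; rewrite !ltW.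
  have bdU mu A := bd mu U A lU (fun t ht => (IH t ht).1).
  have bdV mu A := bd mu V A lV (fun t ht => (IH t ht).2).
  have F1 (A : set R) : measurable A -> cn (cint sig (E `&` A) V) <= C / 2.
    by move=> mA; have := bdV sig A mA; have := ler_wpM2l C0 sm1; lra.
  have F2 (A : set R) : measurable A ->
      cn (cint chi (E `&` A) U - z * cint rho (E `&` A) U - 0) <= C / 2.
    move=> mA; rewrite subr0; apply: le_trans (cnB _ _) _.
    have h1 := bdU chi A mA.
    have h2 := le_trans (cnM z (cint rho (E `&` A) U)) (ler_wpM2l (cn_ge0 z) (bdU rho A mA)).
    have := ler_wpM2l C0 sm2; lra.
  have [xe|ex] := leP x e.
    have [] := S x e; [by case/andP: xab|by []|by []|].
    rewrite Ue Ve cint0 !sub0r -/E => e1 e2.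
    by rewrite -(cnN (U x)) -(cnN (V x)) e1 e2; split; [exact: F1|exact: F2].
  have [] := S e x; [by []|exact: ltW|by case/andP: xab|].
  rewrite Ue Ve cint0 !subr0 -/E => -> ->.
  by split; [exact: F1|rewrite -[X in cn X]subr0; exact: F2].
move=> x xab; split; apply/cn_eq0; apply: (@le0_half_pow _ B) => n.
  by have [] := HB x n xab.
by have [] := HB x n xab.
Qed.

End LocalSolution.

(** * Solutions on (a,b) *)

(** Lets [ring] transfer an equation to a rearranged one by comparing the differences of their
    sides. *)
Lemma eq_from_sub (V : zmodType) (x y x' y' : V) : x - y = x' - y' -> x' = y' -> x = y.
Proof. by move=> e xy; apply/eqP; rewrite -subr_eq0 e xy subrr. Qed.

Section GlobalSolution.
Variables (R : realType) (a b : \bar R) (rho sig chi : lfcm a b).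
Notation I := (Iab a b).
Notation sys := (sys rho sig chi).
Notation presys := (presys rho sig chi).
Notation small := (small rho sig chi).
Notation jump1 := (jump1 sig).
Notation jump2 := (jump2 rho chi).
Implicit Types (f h u v g U V : R -> R[i]) (mu : lfcm a b) (z : R[i]).

Definition seg (x y : R) : set R := [set t | x <= t <= y].

Lemma seg_Iab (x y : R) : I x -> I y -> seg x y `<=` I.
Proof. by move=> Ix Iy t; exact: Iab_interval. Qed.

Lemma seg_convex (x y s t r : R) : seg x y s -> seg x y t -> s <= r <= t -> seg x y r.
Proof.
move=> /andP[xs _] /andP[_ ty] /andP[sr rt].
by rewrite /seg /= (le_trans xs sr) (le_trans rt ty).
Qed.

Lemma seg_sub (x y x' y' : R) : x' <= x -> y <= y' -> seg x y `<=` seg x' y'.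
Proof.
by move=> xx yy t /andP[xt ty]; rewrite /seg /= (le_trans xx xt) (le_trans ty yy).
Qed.

(** To the right of [al] the functions coincide, and [[x, y[] contains [al] only when [x = al]; then
    the atom is split off. *)
Lemma cint_puncture mu f h (al be x y : R) : I al -> I be -> lbm a b f ->
  (forall t, al < t -> f t = h t) -> al <= x -> x < y -> y <= be ->
  cint mu `[x, y[%classic f = (if x <= al then cmeas mu [set al] * f al else 0) +
    cint mu (`]al, be[%classic `&` `[x, y[%classic) h.
Proof.
move=> Ial Ibe lf fh alx xy ybe.
have Ix : I x by apply: (Iab_interval Ial Ibe); rewrite alx (le_trans (ltW xy) ybe).
have Iy : I y by apply: (Iab_interval Ial Ibe); rewrite ybe (le_trans alx (ltW xy)).
rewrite (@eq_cint _ _ _ mu (_ `&` _) h f); last first.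
  by move=> t [+ _]; rewrite /= in_itv/= => /andP[alt _]; rewrite fh.
have [xal|alx'] := leP x al.
  have -> : x = al by apply/le_anti; rewrite xal.
  have al_y : al < y by apply: le_lt_trans alx xy.
  rewrite (cint_co_head (lbm_L1loc mu lf))//; congr (_ + cint mu _ f).
  apply/seteqP; split=> t /=; rewrite !in_itv/=; last by case=> /andP[-> _] /andP[].
  by move=> /andP[alt ty]; rewrite alt (ltW alt) ty (lt_le_trans ty ybe).
rewrite add0r; congr (cint mu _ f).
apply/seteqP; split=> t /=; rewrite !in_itv/=; last by case.
by move=> /andP[xt ty]; rewrite xt ty (lt_le_trans ty ybe) (lt_le_trans alx' xt).
Qed.

(* Subtracting the atom at [al] from the integrals amounts to replacing the
   values of [u], [v] at [al] by their right limits. *)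
Lemma sys_presysP z g (al be : R) u v U V : I al -> I be ->
  lbm a b u -> lbm a b v ->
  (forall t, al < t -> u t = U t) -> (forall t, al < t -> v t = V t) ->
  jump1 al u v = U al -> jump2 z al u v = V al ->
  sys z g (seg al be) u v <-> presys z g al be U V.
Proof.
move=> Ial Ibe lu lv uU vV J1 J2.
have key x y : al <= x -> x < y -> y <= be ->
  (u y - u x = cint sig `[x, y[%classic v /\
    v y - v x = cint chi `[x, y[%classic u - z * cint rho `[x, y[%classic u
              - cint rho `[x, y[%classic g) <->
  (U y - U x = cint sig (`]al, be[%classic `&` `[x, y[%classic) V /\
    V y - V x = cint chi (`]al, be[%classic `&` `[x, y[%classic) U
    - z * cint rho (`]al, be[%classic `&` `[x, y[%classic) U - cint rho `[x, y[%classic g).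
  move=> alx xy ybe; have al_y := le_lt_trans alx xy.
  rewrite (uU _ al_y) (vV _ al_y).
  rewrite (cint_puncture sig Ial Ibe lv vV alx xy ybe).
  rewrite !(cint_puncture _ Ial Ibe lu uU alx xy ybe).
  have [xal|alx'] := leP x al; last by rewrite uU// vV// !add0r.
  have -> : x = al by apply/le_anti; rewrite xal.
  rewrite -J1 -J2 /jump1 /jump2.
  (* At [x = al] the atoms on one side are the jumps hidden in [U al] and [V al] on the other. *)
  set p := cint sig _ _; set q := cint chi _ _; set r := cint rho _ U; set s := cint rho _ g.
  by split=> -[e1 e2]; split; try (apply: (eq_from_sub _ e1); ring);
    try (apply: (eq_from_sub _ e2); ring).
split=> S x y.
- move=> alx xy ybe; have [->|xy'] := eqVneq x y.
    rewrite !subrr (_ : _ `&` _ = set0) ?cint_set0 ?cint_itvxx; first by split=> //; ring.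
    by rewrite set_itvco0 setI0.
  have {}xy' : x < y by rewrite lt_neqAle xy'.
  apply/key => //; apply: S => //; rewrite /seg /=.
    by rewrite alx (le_trans xy ybe).
  by rewrite (le_trans alx xy).
- move=> /andP[alx xbe] /andP[aly ybe] xy; have [->|xy'] := eqVneq x y.
    by rewrite !subrr !cint_itvxx; split=> //; ring.
  have {}xy' : x < y by rewrite lt_neqAle xy'.
  by apply/key => //; exact: S.
Qed.

(** Solvability from every point [e], not just an end point, is what makes the property stable under
    concatenation. Uniqueness is stated for the homogeneous system and carries over to any [g] by
    linearity. *)
Definition good z g (al be : R) := forall e, al <= e <= be ->
  (forall d1 d2, exists u v, [/\ lbm a b u, lbm a b v, sys z g (seg al be) u v,
     u e = d1 & v e = d2]) /\
  (forall u v, lbm a b u -> lbm a b v -> sys z (fun=> 0) (seg al be) u v ->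
     u e = 0 -> v e = 0 -> forall x, al <= x <= be -> u x = 0 /\ v x = 0).

Lemma good_refl z g (x : R) : good z g x x.
Proof.
move=> e /le_anti <-; split.
  move=> d1 d2; exists (fun=> d1), (fun=> d2); split; try exact: lbm_cst.
  - move=> s t /le_anti <- /le_anti <- _.
    by rewrite !cint_itvxx; split=> //; ring.
  - by [].
  - by [].
by move=> u v _ _ _ ux vx y /le_anti <-.
Qed.

Lemma good_local z g (al be : R) : I al -> I be -> al < be -> L1loc rho g ->
  small z `]al, be[%classic ->
  cmeas sig [set al] * (cmeas chi [set al] - z * cmeas rho [set al]) != 1 ->
  good z g al be.
Proof.
move=> Ial Ibe albe Lg sm; set s := cmeas sig _; set t := (X in s * X) => st e eab.
have D0 : 1 - s * t != 0 by rewrite subr_eq0 eq_sym.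
have gt_le (x : R) : al < x -> (x <= al) = false by move=> ?; apply/negbTE; rewrite -ltNge.
split.
  move=> d1 d2.
  (* [presys] prescribes right limits at [al]; if [e = al], the data are first sent through the
     jump. *)
  have [U [V [bU bV S Ue Ve]]] := presys_exists
    (if e <= al then d1 + s * d2 else d1) (if e <= al then d2 + t * d1 else d2) Ial Ibe Lg sm eab.
  have lU := bm_lbm a b bU; have lV := bm_lbm a b bV.
  (* Cramer's rule for the jump matrix, of determinant [1 - s * t], recovers the values at [al]. *)
  pose w1 := (U al - s * V al) / (1 - s * t); pose w2 := (V al - t * U al) / (1 - s * t).
  have lu := lbm_if al (lbm_cst a b w1) lU.
  have lv := lbm_if al (lbm_cst a b w2) lV.
  exists (fun x => if x <= al then w1 else U x), (fun x => if x <= al then w2 else V x); split=> //.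
  - apply/(@sys_presysP z g al be _ _ U V) => //.
    + by move=> x /gt_le ->.
    + by move=> x /gt_le ->.
    + by rewrite /jump1 lexx -/s /w1 /w2; field.
    + by rewrite /jump2 lexx -/t /w1 /w2; field.
  - case: ifPn Ue Ve => [eal|_ -> _ //]; have -> : e = al by apply/le_anti; rewrite eal; case/andP: eab.
    by rewrite /w1 => -> ->; field.
  - case: ifPn Ue Ve => [eal|_ _ -> //]; have -> : e = al by apply/le_anti; rewrite eal; case/andP: eab.
    by rewrite /w2 => -> ->; field.
move=> u v lu lv S ue ve.
pose U := (fun x => if x <= al then jump1 al u v else u x).
pose V := (fun x => if x <= al then jump2 z al u v else v x).
have uU x : al < x -> u x = U x by rewrite /U => /gt_le ->.
have vV x : al < x -> v x = V x by rewrite /V => /gt_le ->.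
have J1 : jump1 al u v = U al by rewrite /U lexx.
have J2 : jump2 z al u v = V al by rewrite /V lexx.
have lU : lbm a b U by apply: lbm_if => //; exact: lbm_cst.
have lV : lbm a b V by apply: lbm_if => //; exact: lbm_cst.
have P : presys z (fun=> 0) al be U V by apply/(@sys_presysP z _ al be u v).
have [Ue Ve] : U e = 0 /\ V e = 0.
  rewrite /U /V; case: ifPn => // eal; have eE : e = al by apply/le_anti; rewrite eal; case/andP: eab.
  by rewrite /jump1 /jump2 -eE ue ve; split; ring.
have H := presys0_unique Ial Ibe lU lV sm eab P Ue Ve.
move=> x /andP[alx xbe]; move: alx; rewrite le_eqVlt => /predU1P[<-|alx]; last first.
  by rewrite uU// vV//; apply: H; rewrite ltW.
have [] := H al; first by rewrite lexx ltW.
rewrite -J1 -J2 /jump1 /jump2 -/s -/t => e1 e2.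
have u0 : u al = 0.
  apply: (mulfI D0); rewrite mulr0.
  rewrite (_ : (1 - s * t) * u al = (u al + s * v al) - s * (v al + t * u al)); last first.
    by ring.
  by rewrite e1 e2; ring.
by split=> //; move: e2; rewrite u0 mulr0 addr0.
Qed.

(** The problem is solved on the piece containing [e], and the values found at [y] serve as data on
    the other piece. Equal values at [y] have equal jumps, so the pieces glue. *)
Lemma good_cat z g (x y w : R) : I x -> I w -> x <= y -> y <= w -> L1loc rho g ->
  good z g x y -> good z g y w -> good z g x w.
Proof.
move=> Ix Iw xy yw Lg G1 G2 e /andP[xe ew].
have Iy : I y by apply: (Iab_interval Ix Iw); rewrite xy.
have yxy : x <= y <= y by rewrite xy lexx.
have yyw : y <= y <= w by rewrite yw lexx.
have DI := seg_Iab Ix Iw.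
have glue u v u' v' : lbm a b u -> lbm a b v -> lbm a b u' -> lbm a b v' ->
    sys z g (seg x y) u v -> sys z g (seg y w) u' v' -> u' y = u y -> v' y = v y ->
    sys z g (seg x w) (fun t => if t <= y then u t else u' t)
                      (fun t => if t <= y then v t else v' t).
  move=> lu lv lu' lv' S S' uu vv; apply: sys_glue => //.
  - by rewrite /seg /= xy.
  - by apply: sys_sub S => t [/andP[xt _] ty]; rewrite /seg /= xt.
  - by apply: sys_sub S' => t [/andP[_ tw] yt]; rewrite /seg /= tw andbT.
  - by rewrite /jump1 uu vv.
  - by rewrite /jump2 uu vv.
split.
- move=> d1 d2; have [ey|ye] := leP e y.
    have eE : x <= e <= y by rewrite xe.
    have [u [v [lu lv S ue ve]]] := (G1 e eE).1 d1 d2.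
    have [u' [v' [lu' lv' S' uu vv]]] := (G2 y yyw).1 (u y) (v y).
    exists (fun t => if t <= y then u t else u' t), (fun t => if t <= y then v t else v' t).
    by split; [exact: lbm_if|exact: lbm_if|exact: glue|rewrite ey|rewrite ey].
  have eE : y <= e <= w by rewrite ew ltW.
  have [u' [v' [lu' lv' S' ue ve]]] := (G2 e eE).1 d1 d2.
  have [u [v [lu lv S uu vv]]] := (G1 y yxy).1 (u' y) (v' y).
  exists (fun t => if t <= y then u t else u' t), (fun t => if t <= y then v t else v' t).
  by split; [exact: lbm_if|exact: lbm_if|exact: glue|rewrite leNgt ye|rewrite leNgt ye].
- move=> u v lu lv S ue ve.
  have S1 : sys z (fun=> 0) (seg x y) u v by apply: sys_sub S; exact: seg_sub.
  have S2 : sys z (fun=> 0) (seg y w) u v by apply: sys_sub S; exact: seg_sub.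
  have [uy vy] : u y = 0 /\ v y = 0.
    have [ey|ye] := leP e y.
      by apply: (G1 e _).2 => //; rewrite xe.
    by apply: (G2 e _).2 => //; rewrite ew ltW.
  move=> t /andP[xt tw]; have [ty|yt] := leP t y.
    by apply: (G1 y _).2 => //; rewrite xt.
  by apply: (G2 y _).2 => //; rewrite tw ltW.
Qed.

(** Let [s] be the supremum of the [t] in [[x, y]] reached from [x]. The hypothesis to the left of
    [s] shows that [s] is reached, and the one to its right passes beyond [s] unless [s = y]. *)
Lemma interval_induction (Q : R -> R -> Prop) :
  (forall x, I x -> Q x x) ->
  (forall x y w, I x -> I w -> x <= y -> y <= w -> Q x y -> Q y w -> Q x w) ->
  (forall x, I x -> exists2 d, 0 < d & forall y, I y -> x < y <= x + d -> Q x y) ->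
  (forall x, I x -> exists2 d, 0 < d & forall y, I y -> x - d <= y < x -> Q y x) ->
  forall x y, I x -> I y -> x <= y -> Q x y.
Proof.
move=> Qxx Qcat Qr Ql x y Ix Iy xy.
pose S : set R := [set t | x <= t <= y /\ Q x t].
have Sx : S x by split; [rewrite lexx|exact: Qxx].
have Sb : has_ubound S by exists y => t [/andP[]].
have supS : has_sup S by split=> //; exists x.
set s := sup S.
have xs : x <= s by exact: ub_le_sup.
have sy : s <= y by apply: ge_sup; [exists x|move=> t [/andP[]]].
have Is : I s by apply: (Iab_interval Ix Iy); rewrite xs.
have Qxs : Q x s.
  have [d d0 Hd] := Ql s Is.
  have [t [/andP[xt ty] Qxt] st] := sup_adherent d0 supS.
  have ts : t <= s by apply: ub_le_sup => //; split=> //; rewrite xt.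
  have It : I t by apply: (Iab_interval Ix Iy); rewrite xt.
  move: (ts); rewrite le_eqVlt => /predU1P[<-//|ts'].
  by apply: (Qcat x t s) => //; apply: Hd => //; rewrite ts' (ltW st).
move: (sy); rewrite le_eqVlt => /predU1P[<-//|sy'].
have [d d0 Hd] := Qr s Is; pose w := Num.min (s + d) y.
have sw : s < w by rewrite lt_min sy' ltrDl d0.
have wy : w <= y by rewrite ge_min lexx orbT.
have Iw : I w by apply: (Iab_interval Ix Iy); rewrite wy (le_trans xs (ltW sw)).
have Sw : S w.
  split; first by rewrite wy (le_trans xs (ltW sw)).
  apply: (Qcat x s w) => //; first exact: ltW.
  by apply: Hd => //; rewrite sw ge_min lexx.
by have := ub_le_sup Sb Sw; rewrite leNgt -/s sw.
Qed.

(** Common core of the two one-sided cases: [F d] stands for an open interval of length [d] on one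
    side of a point, and the least of finitely many radii suits all components of the three
    measures. *)
Lemma small_shrink z (F : R -> set R) (d0 : R) : 0 < d0 ->
  (forall d d', d <= d' -> F d `<=` F d') -> (forall d, measurable (F d)) ->
  rcompact a b (F d0) ->
  (forall (m : {measure set R -> \bar R}) e, 0 < e -> (m (F d0) < +oo)%E ->
    exists2 d, 0 < d & (m (F d) <= e%:E)%E) ->
  exists2 d, 0 < d & forall A, measurable A -> A `<=` F d -> small z A.
Proof.
move=> d00 Fmono mF Fc Fsmall.
have F1 mu e : 0 < e -> exists2 d, 0 < d &
    forall d' A, d' <= d -> measurable A -> A `<=` F d' -> tvr mu A <= e.
  move=> e0; have e4 : 0 < e / 4 by rewrite divr_gt0.
  have L i j : exists2 d, 0 < d &
      forall d' A, d' <= d -> measurable A -> A `<=` F d' -> fine (cpart mu i j A) <= e / 4.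
    have [d dpos Hd] := Fsmall (cpart mu i j) _ e4 (rcompact_fin mu i j Fc).
    exists d => // d' A d'd mA sub.
    have le : (cpart mu i j A <= (e / 4)%:E)%E.
      apply: le_trans Hd; apply: le_measure; rewrite ?inE//.
      by apply: subset_trans sub _; exact: Fmono.
    by rewrite -lee_fin fineK// ge0_fin_numE//; apply: le_lt_trans le (ltry _).
  have [d1 d10 H1] := L true true; have [d2 d20 H2] := L true false.
  have [d3 d30 H3] := L false true; have [d4 d40 H4] := L false false.
  exists (Num.min (Num.min d1 d2) (Num.min d3 d4)); first by rewrite !lt_min d10 d20 d30.
  move=> d A; rewrite !le_min => /andP[/andP[l1 l2] /andP[l3 l4]] mA sub.
  have := H1 d A l1 mA sub; have := H2 d A l2 mA sub.
  have := H3 d A l3 mA sub; have := H4 d A l4 mA sub.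
  by rewrite /tvr /=; lra.
(* With this bound on each variation, the one of [chi] plus [cn z] times that of [rho] is at most
   [8^-1]. *)
have e0 : 0 < (8 * (1 + cn z))^-1 by rewrite invr_gt0 mulr_gt0// ltr_pwDl// cn_ge0.
have [d1 d10 H1] := F1 sig _ e0; have [d2 d20 H2] := F1 chi _ e0.
have [d3 d30 H3] := F1 rho _ e0.
have eE : (1 + cn z) * (8 * (1 + cn z))^-1 = 8^-1.
  by field; rewrite gt_eqF// ltr_pwDl// cn_ge0.
exists (Num.min d1 (Num.min d2 d3)); first by rewrite !lt_min d10 d20.
move=> A mA; set d := Num.min _ _ => sub.
have [l1 l2 l3] : [/\ d <= d1, d <= d2 & d <= d3] by split; rewrite /d !ge_min lexx ?orbT.
have h1 := H1 d A l1 mA sub; have h2 := H2 d A l2 mA sub.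
have h3 := ler_wpM2l (cn_ge0 z) (H3 d A l3 mA sub).
have h4 := mulr_ge0 (cn_ge0 z) (ltW e0).
by split; move: eE h1 h2 h3 h4 e0; set e := (8 * _)^-1; rewrite mulrDl mul1r; lra.
Qed.

Lemma small_right z (x : R) : I x -> exists2 d, 0 < d &
  forall y, x < y <= x + d -> small z `]x, y[%classic.
Proof.
move=> Ix; have [d0 d00 H0] := Iab_open Ix.
have [||||d dpos Hd] := @small_shrink z (fun d => `]x, (x + d)[%classic) d0 d00.
- move=> d d' dd t; rewrite /= !in_itv/= => /andP[-> tx].
  by apply: lt_le_trans tx _; rewrite lerD2l.
- by move=> d; exact: measurable_itv.
- by apply: rcompact_itv => //; apply: H0; lra.
- by move=> m e e0 fin; exact: measure_small_right d00 e0 fin.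
exists d => // y /andP[xy yd]; apply: Hd; first exact: measurable_itv.
move=> t; rewrite /= !in_itv/= => /andP[-> ty].
by apply: lt_le_trans ty _.
Qed.

Lemma small_left z (x : R) : I x -> exists2 d, 0 < d &
  forall y, x - d <= y < x -> small z `]y, x[%classic.
Proof.
move=> Ix; have [d0 d00 H0] := Iab_open Ix.
have [||||d dpos Hd] := @small_shrink z (fun d => `](x - d), x[%classic) d0 d00.
- move=> d d' dd t; rewrite /= !in_itv/= => /andP[tx ->]; rewrite andbT.
  by apply: le_lt_trans tx; rewrite lerD2l lerN2.
- by move=> d; exact: measurable_itv.
- by apply: rcompact_itv => //; apply: H0; lra.
- by move=> m e e0 fin; exact: measure_small_left d00 e0 fin.
exists d => // y /andP[xy yd]; apply: Hd; first exact: measurable_itv.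
move=> t; rewrite /= !in_itv/= => /andP[yt ->]; rewrite andbT.
by apply: le_lt_trans yt.
Qed.

(** No jump matrix of the system with parameter [z] is singular. *)
Definition regular z := forall x, I x ->
  cmeas sig [set x] * (cmeas chi [set x] - z * cmeas rho [set x]) != 1.

Lemma good_all z g (x y : R) : L1loc rho g -> regular z ->
  I x -> I y -> x <= y -> good z g x y.
Proof.
move=> Lg reg; apply: interval_induction => [s _|s t r Is Ir st tr|s Is|s Is].
- exact: good_refl.
- exact: good_cat.
- have [d dpos Hd] := small_right z Is; exists d => // t It st.
  by have /andP[st' _] := st; apply: good_local => //; [exact: Hd|exact: reg].
- have [d dpos Hd] := small_left z Is; exists d => // t It st.
  by have /andP[_ st'] := st; apply: good_local => //; [exact: Hd|exact: reg].
Qed.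

Lemma sys_unique0 z (c : R) u v : regular z -> I c -> lbm a b u -> lbm a b v ->
  sys z (fun=> 0) I u v -> u c = 0 -> v c = 0 -> forall x, I x -> u x = 0 /\ v x = 0.
Proof.
move=> reg Ic lu lv S uc vc x Ix.
have Im : I (Num.min c x) by rewrite minEle; case: ifP.
have IM : I (Num.max c x) by rewrite maxEle; case: ifP.
have mM : Num.min c x <= Num.max c x by rewrite ge_min !le_max lexx.
have L0 : L1loc rho (fun=> 0) by apply: lbm_L1loc; exact: lbm_cst.
have cin : Num.min c x <= c <= Num.max c x by rewrite ge_min le_max lexx.
have G := good_all L0 reg Im IM mM.
apply: (G c cin).2 uc vc _ _ => //; first by apply: sys_sub S; exact: seg_Iab.
by rewrite ge_min le_max lexx !orbT.
Qed.

(** A solution is chosen on every compact interval around [c]; uniqueness makes the choices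
    compatible, and they patch together on (a,b). *)
Lemma sys_exists z g (c : R) (d1 d2 : R[i]) : L1loc rho g -> regular z -> I c ->
  exists u v, [/\ lbm a b u, lbm a b v, sys z g I u v, u c = d1 & v c = d2].
Proof.
move=> Lg reg Ic.
have /choice[S HS] (p : R * R) : exists uv : (R -> R[i]) * (R -> R[i]),
    I p.1 -> I p.2 -> p.1 <= c <= p.2 ->
    [/\ lbm a b uv.1, lbm a b uv.2, sys z g (seg p.1 p.2) uv.1 uv.2, uv.1 c = d1 & uv.2 c = d2].
  (* The zero pair is a dummy value for pairs that do not bound an interval around [c] inside
     (a,b). *)
  have [[I1 [I2 pc]]|no] := pselect (I p.1 /\ I p.2 /\ p.1 <= c <= p.2); last first.
    by exists (fun=> 0, fun=> 0) => I1 I2 pc; exfalso; apply: no.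
  have p12 : p.1 <= p.2 by case/andP: pc => /le_trans; apply.
  have [u [v H]] := (good_all Lg reg I1 I2 p12 pc).1 d1 d2.
  by exists (u, v).
pose lo x := Num.min c x; pose hi x := Num.max c x.
have Ilo x : I x -> I (lo x) by rewrite /lo minEle; case: ifP.
have Ihi x : I x -> I (hi x) by rewrite /hi maxEle; case: ifP.
have cin x y : lo x <= c <= hi y by rewrite ge_min le_max lexx.
(* The value at [x] is read off the solution on the interval between [c] and [x]; [agree] shows that
   larger intervals give the same value. *)
pose u x := (S (lo x, hi x)).1 x; pose v x := (S (lo x, hi x)).2 x.
have agree x y t : I x -> I y -> x <= t <= y ->
    u t = (S (lo x, hi y)).1 t /\ v t = (S (lo x, hi y)).2 t.
  move=> Ix Iy xty; have It := Iab_interval Ix Iy xty; have /andP[xt ty] := xty.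
  have [] := HS (lo x, hi y) (Ilo _ Ix) (Ihi _ Iy) (cin _ _).
  have [] := HS (lo t, hi t) (Ilo _ It) (Ihi _ It) (cin _ _) => /=.
  move=> lu lv Su uc vc lu' lv' Su' uc' vc'.
  have tt : lo t <= hi t by rewrite ge_min !le_max lexx.
  have sub : seg (lo t) (hi t) `<=` seg (lo x) (hi y).
    apply: seg_sub; first by rewrite le_min !ge_min lexx xt !orbT.
    by rewrite ge_max !le_max lexx ty !orbT.
  have SB := sysB (seg_Iab (Ilo _ It) (Ihi _ It)) lu lv lu' lv' Su (sys_sub sub Su').
  have [||//|||e1 e2] := (good_all Lg reg (Ilo _ It) (Ihi _ It) tt (cin t t)).2 _ _ _ _ SB _ _ t.
  - exact: lbmB.
  - exact: lbmB.
  - by rewrite uc uc' subrr.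
  - by rewrite vc vc' subrr.
  - by rewrite ge_min le_max lexx !orbT.
  by split; [exact: subr0_eq e1|exact: subr0_eq e2].
have [lu lv] : lbm a b u /\ lbm a b v.
  split; apply: lbm_exhaust => x y Ix Iy xy.
    exists (S (lo x, hi y)).1; last by move=> t /(agree x y t Ix Iy)[].
    by case: (HS (lo x, hi y) (Ilo _ Ix) (Ihi _ Iy) (cin _ _)).
  exists (S (lo x, hi y)).2; last by move=> t /(agree x y t Ix Iy)[].
  by case: (HS (lo x, hi y) (Ilo _ Ix) (Ihi _ Iy) (cin _ _)).
exists u, v; split=> //.
- move=> x y Ix Iy xy.
  have [_ _ Sxy _ _] := HS (lo x, hi y) (Ilo _ Ix) (Ihi _ Iy) (cin _ _).
  have sub : seg x y `<=` seg (lo x) (hi y).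
    by apply: seg_sub; rewrite ?ge_min ?le_max lexx orbT.
  have S' := sys_sub sub Sxy.
  have : sys z g (seg x y) u v.
    apply: (eq_sys _ _ _ S').
    + by move=> s t r; exact: seg_convex.
    + by move=> t /(agree x y t Ix Iy)[].
    + by move=> t /(agree x y t Ix Iy)[].
  by apply=> //; rewrite /seg /= lexx ?xy.
- by have [_ _ _ uc _] := HS (lo c, hi c) (Ilo _ Ic) (Ihi _ Ic) (cin _ _).
- by have [_ _ _ _ vc] := HS (lo c, hi c) (Ilo _ Ic) (Ihi _ Ic) (cin _ _).
Qed.

End GlobalSolution.

(** * Real data and singular jumps *)

Section RealAndSingular.
Variables (R : realType) (a b : \bar R).
Notation I := (Iab a b).
Implicit Types (f h u v g : R -> R[i]) (mu rho sig chi : lfcm a b) (z : R[i]).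

(** On each half of the set separating [cm3] from [cm4] one of them vanishes; their difference is 0
    there, so the other vanishes too. *)
Lemma real_cm_null mu A : real_cm mu -> rcompact a b A -> cm3 mu A = 0%E /\ cm4 mu A = 0%E.
Proof.
move=> re cA; have [S [mS S3 S4]] := cm34_sing mu; have mA := cA.1.
have cAS : rcompact a b (A `&` S) by exact: rcompactI.
have cAC : rcompact a b (A `&` ~` S) by apply: rcompactI => //; exact: measurableC.
have E : A = (A `&` S) `|` (A `&` ~` S) by rewrite -setIUr setUv setIT.
have dj : (A `&` S) `&` (A `&` ~` S) = set0.
  by apply/seteqP; split=> // t [[_ St] [_ /(_ St)]].
have le0 (m : {measure set R -> \bar R}) (B C : set R) : measurable B -> measurable C ->
    B `<=` C -> m C = 0%E -> m B = 0%E.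
  move=> mB mC BC C0; apply/eqP; rewrite eq_le measure_ge0 andbT -C0.
  by apply: le_measure; rewrite ?inE.
have z3 : cm3 mu (A `&` S) = 0%E by apply: le0 S3 => //; exact: cAS.1.
have z4 : cm4 mu (A `&` ~` S) = 0%E.
  by apply: le0 S4 => //; [exact: cAC.1|exact: measurableC].
have fin i j B : rcompact a b B -> cpart mu i j B \is a fin_num.
  by move=> cB; rewrite ge0_fin_numE//; exact: rcompact_fin.
have w3 : cm3 mu (A `&` ~` S) = 0%E.
  have := re _ cAC.1 cAC.2; rewrite /cmeas /= z4 /= subr0 => e.
  by rewrite -[LHS]fineK ?e//; exact: (fin false true).
have w4 : cm4 mu (A `&` S) = 0%E.
  have := re _ cAS.1 cAS.2; rewrite /cmeas /= z3 /= sub0r => /eqP; rewrite oppr_eq0 => /eqP e.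
  by rewrite -[LHS]fineK ?e//; exact: (fin false false).
have mU (m : {measure set R -> \bar R}) : m A = (m (A `&` S) + m (A `&` ~` S))%E.
  by rewrite {1}E measureU//; [exact: cAS.1|exact: cAC.1].
by rewrite !mU z3 w3 z4 w4 !adde0.
Qed.

(** The imaginary part is kept complex-valued so that [sys] applies to it. *)
Definition imc f : R -> R[i] := fun x => Complex (complex.Im (f x)) 0.

(** With [cm3] and [cm4] null on [A], integration acts separately on real and imaginary parts. *)
Lemma cint_imc mu A h : real_cm mu -> rcompact a b A -> cintegrable mu A h ->
  cint mu A (imc h) = Complex (complex.Im (cint mu A h)) 0.
Proof.
move=> re cA H; have [z3 z4] := real_cm_null re cA; have mA := cA.1.
have R0 (m : {measure set R -> \bar R}) (f : R -> R) : m A = 0%E ->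
    m.-integrable A (EFin \o f) -> Rintegral m A f = 0.
  move=> mA0 /integrableP[mf _].
  by rewrite /Rintegral null_set_integral.
have [h3 h3'] := H false true; have [h4 h4'] := H false false.
have c0 (m : {measure set R -> \bar R}) : Rintegral m A (fun=> 0) = 0.
  by rewrite /Rintegral integral0.
rewrite /cint /imc /= !c0 (R0 _ _ z3 h3) (R0 _ _ z3 h3') (R0 _ _ z4 h4) (R0 _ _ z4 h4').
by rewrite !(subr0, addr0).
Qed.

Lemma lbm_imc f : lbm a b f -> lbm a b (imc f).
Proof.
move=> [[fr fi] bf]; split; first by split=> //; exact: measurable_cst.
move=> x y Ix Iy; have [B HB] := bf _ _ Ix Iy; exists B => t /HB; apply: le_trans.
by rewrite /cn /= normr0 addr0 lerDr.
Qed.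

Lemma sys_imc rho sig chi z g u v : real_cm rho -> real_cm sig -> real_cm chi ->
  ae rho (fun x => complex.Im (g x) = 0) -> complex.Im z = 0 -> L1loc rho g ->
  lbm a b u -> lbm a b v ->
  sys rho sig chi z g I u v -> sys rho sig chi z (fun=> 0) I (imc u) (imc v).
Proof.
move=> rr rs rc [N [mN N0 gN]] z0 Lg lu lv S x y Ix Iy xy.
have [S1 S2] := S x y Ix Iy xy.
have cxy : rcompact a b `[x, y[%classic by exact: rcompact_itv.
have ImB (p q : R[i]) : complex.Im (p - q) = complex.Im p - complex.Im q.
  by case: p q => [? ?] [? ?].
have imB f : imc f y - imc f x = Complex (complex.Im (f y - f x)) 0.
  by rewrite ImB /imc; apply/eqP; rewrite eq_complex /= subrr !eqxx.
have g0 : complex.Im (cint rho `[x, y[%classic g) = 0.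
  have E : cint rho `[x, y[%classic (imc g) = 0.
    rewrite -(cint0 rho `[x, y[%classic); apply: (null_eq_cint cxy.1 mN N0).
    - move=> i j; have [_ gi] := L1loc_integrable Lg cxy i j.
      by split=> //; exact: integrable0.
    - exact: cintegrable0.
    - move=> t; rewrite /= in_itv/= => /andP[xt /ltW ty] Nt; rewrite /imc gN//.
      by apply: (Iab_interval Ix Iy); rewrite xt.
  by have := cint_imc rr cxy (L1loc_integrable Lg cxy); rewrite E => -[].
rewrite !imB S1 S2 cint0 subr0 !cint_imc//; try exact: rcompact_integrable.
split=> //; rewrite !ImB g0 subr0.
set r := cint chi _ _; set s := cint rho _ _; case: z z0 {S S2} => p q /= ->.
by case: r s => [? ?] [? ?]; apply/eqP; rewrite eq_complex /=; apply/andP; split; apply/eqP; ring.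
Qed.

(** The hypothesis to be refuted itself supplies the solutions starting at [x]. After gluing, two
    solutions agree to the right of [x] but differ at [x]. *)
Lemma singular_jump_not_unique rho sig chi z g (x : R) : L1loc rho g -> I x ->
  cmeas sig [set x] * (cmeas chi [set x] - z * cmeas rho [set x]) = 1 ->
  ~ (forall (c : R) (d1 d2 : R[i]), I c ->
      (exists u, is_solution rho sig chi g z c d1 d2 u) /\
      (forall u v, is_solution rho sig chi g z c d1 d2 u ->
                   is_solution rho sig chi g z c d1 d2 v ->
                   forall x, I x -> u x = v x)).
Proof.
move=> Lg Ix; set s := cmeas sig _; set t := (X in s * X) => st H.
have [[w /(is_solution_sys Lg Ix)[w' [lw lw' S wx w'x]]] _] := H x 0 0 Ix.
(* The vector [(s, -1)] spans the kernel of the jump matrix because [s * t = 1], so these data have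
   the same right limits as zero data. *)
have [[u /(is_solution_sys Lg Ix)[v [lu lv S' ux vx]]] _] := H x s (- 1) Ix.
have [d d0 Hd] := Iab_open Ix.
have Ic : I (x + d) by apply: Hd; lra.
have cx : (x + d <= x) = false by apply/negbTE; rewrite -ltNge; lra.
pose U t := if t <= x then u t else w t; pose V t := if t <= x then v t else w' t.
have SG : sys rho sig chi z g I U V.
  apply: sys_glue => //.
  - by apply: sys_sub S' => y [].
  - by apply: sys_sub S => y [].
  - by rewrite /jump1 ux vx wx w'x -/s; ring.
  - by rewrite /jump2 ux vx wx w'x -/t mulrC st; ring.
have := sys_is_solution Lg Ic (lbm_if x lu lw) (lbm_if x lv lw') SG.
rewrite /= cx => solU.
have := (H (x + d) (w (x + d)) (w' (x + d)) Ic).2 _ _ solU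
  (sys_is_solution Lg Ic lw lw' S) x Ix.
(* Uniqueness from [x + d] would force [s = 0], against [s * t = 1]. *)
rewrite /= lexx ux wx => s0; move: st; rewrite s0 mul0r => /eqP.
by rewrite eq_sym oner_eq0.
Qed.

End RealAndSingular.

(** * The equivalence with the atom condition, and real solutions for real data *)

Theorem theorem3p1 (R : realType) (a b : \bar R) (ab : (a < b)%E)
  (rho sig chi : lfcm a b) (Hsupp : supp sig = Iab a b)
  (g : R -> R[i]) (Hg : L1loc rho g) :
  ((forall (z : R[i]) (c : R) (d1 d2 : R[i]), Iab a b c ->
      (exists u, is_solution rho sig chi g z c d1 d2 u) /\
      (forall u v, is_solution rho sig chi g z c d1 d2 u ->
                   is_solution rho sig chi g z c d1 d2 v ->
                   forall x, Iab a b x -> u x = v x))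
   <->
   (forall x, Iab a b x ->
      cmeas rho [set x] * cmeas sig [set x] = 0 /\
      cmeas chi [set x] * cmeas sig [set x] != 1))
  /\
  ((forall x, Iab a b x ->
      cmeas rho [set x] * cmeas sig [set x] = 0 /\
      cmeas chi [set x] * cmeas sig [set x] != 1) ->
   real_cm rho -> real_cm sig -> real_cm chi ->
   ae rho (fun x => complex.Im (g x) = 0) ->
   forall (z : R[i]) (c : R) (d1 d2 : R[i]), Iab a b c ->
   complex.Im z = 0 -> complex.Im d1 = 0 -> complex.Im d2 = 0 ->
   forall u, is_solution rho sig chi g z c d1 d2 u ->
   forall x, Iab a b x -> complex.Im (u x) = 0).
Proof.
(* Without common atoms of [rho] and [sig] the term in [z] drops out, and the determinant is nonzero
   for every [z]. *)
have reg (z : R[i]) : (forall x, Iab a b x -> cmeas rho [set x] * cmeas sig [set x] = 0 /\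
      cmeas chi [set x] * cmeas sig [set x] != 1) -> regular rho sig chi z.
  move=> H x /H[rs0 cs1]; rewrite mulrBr mulrCA [X in z * X]mulrC rs0 mulr0 subr0.
  by rewrite mulrC.
split; [split|].
- move=> H x Ix.
  have ns z := fun e => @singular_jump_not_unique _ _ _ rho sig chi z g x Hg Ix e (H z).
  split.
    apply/eqP/negP => /negP rs0.
    (* At a common atom of [rho] and [sig] the determinant is affine in [z] with nonzero slope; this
       is its root. *)
    apply: (ns ((cmeas chi [set x] * cmeas sig [set x] - 1) /
                (cmeas rho [set x] * cmeas sig [set x]))).
    by move: rs0; rewrite mulf_eq0 negb_or => /andP[r0 s0]; field; rewrite r0 s0.
  (* For [z = 0] the determinant at [x] is one minus the product of the atoms of [chi] and [sig]. *)
  apply/eqP => cs1; apply: (ns 0).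
  by rewrite mul0r subr0 mulrC.
- move=> H z c d1 d2 Ic; have rz := reg z H; split.
    have [u [v [lu lv S uc vc]]] := sys_exists d1 d2 Hg rz Ic.
    by exists u; rewrite -uc -vc; exact: sys_is_solution.
  move=> u w /(is_solution_sys Hg Ic)[u' [lu lu' S uc u'c]].
  move=> /(is_solution_sys Hg Ic)[w' [lw lw' S' wc w'c]] x Ix.
  have SB := sysB (fun _ H => H) lu lu' lw lw' S S'.
  have [||e _] := sys_unique0 rz Ic (lbmB lu lw) (lbmB lu' lw') SB _ _ Ix.
  + by rewrite uc wc subrr.
  + by rewrite u'c w'c subrr.
  + exact: subr0_eq e.
- move=> H rr rs rc g0 z c d1 d2 Ic z0 d10 d20 u /(is_solution_sys Hg Ic)[v [lu lv S uc vc]] x Ix.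
  have S0 := sys_imc rr rs rc g0 z0 Hg lu lv S.
  have [||e _] := sys_unique0 (reg z H) Ic (lbm_imc lu) (lbm_imc lv) S0 _ _ Ix.
  + by rewrite /imc uc d10.
  + by rewrite /imc vc d20.
  + by case: e.
Qed.
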